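(* Let $I_0=[1/10,9/10]$ and $\mathbf c_0(t)=\bigl(\arctan t,\ \tfrac{1}{\sqrt2}\log(1+t^2),\ t-\arctan t\bigr)$, $t\in I_0$ (an arc-length parametrization, with curvature and torsion $\kappa(t)=\tau(t)=\sqrt2/(1+t^2)$), and $C_0=\mathbf c_0(I_0)$. Let $\alpha(t)=\pi(t+10)/24$, let $\mu(t):=\kappa(t)\cos\alpha(t)$, and let $f:=f^{\alpha}$, $\check f:=f^{-\alpha}$ be the developable strips along $\mathbf c_0$; let $\mathbf c_0^\sharp(t)=\mathbf c_0(1-t)$, with curvature $\kappa^\sharp(t)=\kappa(1-t)$, let $\alpha_*:=\arccos(\mu/\kappa^\sharp)\in(0,\pi/2)$, and let $f_*$, $\check f_*$ be the developable strips along $\mathbf c_0^\sharp$ with first angular functions $\alpha_*$, $-\alpha_*$. For $\delta>0$ set $P_1(\delta)=\phi_f(\Omega_\delta)$, $P_2(\delta)=\phi_{\check f}(\Omega_\delta)$, $P_3(\delta)=\phi_{f_*}(\Omega_\delta)$, $P_4(\delta)=\phi_{\check f_*}(\Omega_\delta)$, where $\Omega_\delta=I_0\times(-\delta,\delta)$. Then for every sufficiently small $\epsilon>0$, every $\delta\in(0,\epsilon]$ and all $i,j\in\{1,2,3,4\}$: if an isometry $T$ of $\mathbb R^3$ satisfies $T(P_i(\delta))\subset P_j(\epsilon)$, then $i=j$. In particular the four curved foldings $P_1(\epsilon),\dots,P_4(\epsilon)$, which all have crease $C_0$ and the same crease pattern (the plane curve with curvature $\mu$), are mutually non-congruent.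
   Context: Space curves. For a $C^\infty$ curve $\sigma:I\to\mathbb R^3$ parametrized by arc length with curvature $\kappa_\sigma=|\sigma''|>0$, set $\mathbf e=\sigma'$, $\mathbf n=\sigma''/\kappa_\sigma$, $\mathbf b=\mathbf e\times\mathbf n$, and define the torsion by $\tau_\sigma:=\mathbf n'\cdot\mathbf b$. Developable strips. Given $C^\infty$ functions $\alpha,\beta$ on $I$ with $0<|\alpha(t)|<\pi/2$ and $0<\beta(t)<\pi$, the ruled surface along $\sigma$ is $f(t,v)=\sigma(t)+v\,\xi(t)$ for $(t,v)\in I\times(-\epsilon,\epsilon)$, where $\xi=\cos\beta\,\mathbf e+\sin\beta(\cos\alpha\,\mathbf n+\sin\alpha\,\mathbf b)$; $\alpha$ is the first angular function. $f$ is a developable strip iff $\cot\beta=(\alpha'+\tau_\sigma)/(\kappa_\sigma\sin\alpha)$; the developable strip along $\sigma$ with first angular function $\alpha$ is denoted $f^\alpha$, and the geodesic curvature of $\sigma$ on $f^\alpha$ is $\kappa_\sigma\cos\alpha$. The dual of $f=f^\alpha$ is $\check f:=f^{-\alpha}$. Origami maps. $\phi_f(t,v)=f(t,v)$ for $v\ge0$ and $\phi_f(t,v)=\check f(t,v)$ for $v<0$; $\psi_f(t,v)=\check f(t,v)$ for $v\ge0$ and $\psi_f(t,v)=f(t,v)$ for $v<0$. The image of $\phi_f$ is a curved folding with crease $\sigma(I)$. *)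

(* Defs.v *)
From Stdlib Require Import Reals Lra ClassicalEpsilon.
Open Scope R_scope.

Definition V3 : Type := (R * R * R)%type.
Definition vx (p : V3) : R := fst (fst p).
Definition vy (p : V3) : R := snd (fst p).
Definition vz (p : V3) : R := snd p.
Definition vadd (p q : V3) : V3 := (vx p + vx q, vy p + vy q, vz p + vz q).
Definition vsub (p q : V3) : V3 := (vx p - vx q, vy p - vy q, vz p - vz q).
Definition vscale (a : R) (p : V3) : V3 := (a * vx p, a * vy p, a * vz p).
Definition vdot (p q : V3) : R := vx p * vx q + vy p * vy q + vz p * vz q.
Definition vcross (p q : V3) : V3 :=
  (vy p * vz q - vz p * vy q, vz p * vx q - vx p * vz q, vx p * vy q - vy p * vx q).
Definition vnorm (p : V3) : R := sqrt (vdot p p).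
Definition dist3 (p q : V3) : R := vnorm (vsub p q).

Definition isometry3 (T : V3 -> V3) : Prop :=
  forall p q, dist3 (T p) (T q) = dist3 p q.

(** The derivative of a real function at x (the unique l with
    derivable_pt_lim f x l, chosen classically; meaningful where f is
    differentiable, which is the case for all functions used below). *)
Definition Dr (f : R -> R) (x : R) : R :=
  epsilon (inhabits 0) (fun l => derivable_pt_lim f x l).

Definition Dv (s : R -> V3) (t : R) : V3 :=
  (Dr (fun u => vx (s u)) t, Dr (fun u => vy (s u)) t, Dr (fun u => vz (s u)) t).

(** Frenet data of an arc-length parametrized curve sigma. *)
Definition tangent (s : R -> V3) (t : R) : V3 := Dv s t.
Definition curvature (s : R -> V3) (t : R) : R := vnorm (Dv (Dv s) t).
Definition normal (s : R -> V3) (t : R) : V3 :=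
  vscale (/ curvature s t) (Dv (Dv s) t).
Definition binormal (s : R -> V3) (t : R) : V3 :=
  vcross (tangent s t) (normal s t).
Definition torsion (s : R -> V3) (t : R) : R :=
  vdot (Dv (normal s) t) (binormal s t).

(** The angle beta in (0,pi) with cot beta = (alpha' + tau)/(kappa sin alpha):
    beta = pi/2 - atan (cot beta). *)
Definition dev_beta (s : R -> V3) (a : R -> R) (t : R) : R :=
  PI / 2 - atan ((Dr a t + torsion s t) / (curvature s t * sin (a t))).

Definition ruling (s : R -> V3) (a : R -> R) (t : R) : V3 :=
  let be := dev_beta s a t in
  vadd (vscale (cos be) (tangent s t))
       (vscale (sin be) (vadd (vscale (cos (a t)) (normal s t))
                              (vscale (sin (a t)) (binormal s t)))).
Definition dev_strip (s : R -> V3) (a : R -> R) (t v : R) : V3 :=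
  vadd (s t) (vscale v (ruling s a t)).

(** Origami map phi_f for f = f^alpha (the dual being f^{-alpha}). *)
Definition phi_map (s : R -> V3) (a : R -> R) (t v : R) : V3 :=
  if Rle_dec 0 v then dev_strip s a t v
  else dev_strip s (fun u => - a u) t v.

Definition folding (s : R -> V3) (a : R -> R) (delta : R) (p : V3) : Prop :=
  exists t v, 1/10 <= t <= 9/10 /\ - delta < v < delta /\ p = phi_map s a t v.

Definition c0 (t : R) : V3 := (atan t, / sqrt 2 * ln (1 + t ^ 2), t - atan t).
Definition alpha0 (t : R) : R := PI * (t + 10) / 24.
Definition mu0 (t : R) : R := curvature c0 t * cos (alpha0 t).
Definition c0sharp (t : R) : V3 := c0 (1 - t).
Definition alpha_star (t : R) : R := acos (mu0 t / curvature c0sharp t).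

Definition Pfold (i : nat) (delta : R) : V3 -> Prop :=
  match i with
  | 1%nat => folding c0 alpha0 delta
  | 2%nat => folding c0 (fun u => - alpha0 u) delta
  | 3%nat => folding c0sharp alpha_star delta
  | _     => folding c0sharp (fun u => - alpha_star u) delta
  end.

(* Main.v *)
Require Import Defs.
From Stdlib Require Import Reals Lra Lia Psatz FunctionalExtensionality ClassicalEpsilon.
From Coquelicot Require Import Coquelicot.
Open Scope R_scope.

(** If T maps one folding into another of width eps, it maps the arc C0 into the eps-neighbourhood
    of C0.  Chord lengths of C0 then force T to be O(eps)-close to the identity: a nearly longest
    chord must join points near the two ends of C0, the ends cannot be exchanged because C0 curves
    more at its left end, distances from the left end determine points of C0, and C0 is not planar.

    It remains to compare the foldings infinitesimally at the fixed point c0(1/4).  Near it a folding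
    is a union of two half strips tangent to the half planes spanned by the tangent e and
    C n + S b, resp. - C n + S b, where (C, S) are the cosine and sine of a signed angle: alpha and
    - alpha for P1 and P2, - alpha_* and alpha_* for P3 and P4 (reversing the crease reverses the
    binormal).  A secant of the folding is, up to an error small with respect to its coefficients,
    of the form d e + p xi_+ + m xi_-, where the possible signs of p and m depend on the sheet on
    which the secant starts.  Comparing this with the images under T of a short piece of a ruling on
    either side of c0(1/4) forces the signed angles to agree.  The four angles are distinct since
    mu(1/4) <> mu(3/4). *)

(** * Euclidean space *)

Ltac v3unfold := unfold vsub, vadd, vscale, vdot, vcross, vx, vy, vz in *; cbn [fst snd] in *.
Ltac v3ring := intros; v3unfold; (ring || (apply injective_projections; [apply injective_projections|]; cbn [fst snd]; ring)).

Lemma vdot_self_ge0 p : 0 <= vdot p p.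
Proof. unfold vdot; nra. Qed.

Lemma vnorm_ge0 p : 0 <= vnorm p.
Proof. apply sqrt_pos. Qed.

Lemma vnorm_sqr p : vnorm p * vnorm p = vdot p p.
Proof. apply sqrt_sqrt, vdot_self_ge0. Qed.

Lemma vdotC p q : vdot p q = vdot q p.
Proof. v3ring. Qed.

(** Cauchy-Schwarz by Lagrange's identity: the difference of the squares of the two sides is the
    squared length of [vcross p q]. *)
Lemma Rabs_vdot_le p q : Rabs (vdot p q) <= vnorm p * vnorm q.
Proof.
  rewrite <- (Rabs_pos_eq (vnorm p * vnorm q)) by (apply Rmult_le_pos; apply vnorm_ge0).
  apply Rsqr_le_abs_0; unfold Rsqr.
  replace (vnorm p * vnorm q * (vnorm p * vnorm q)) with (vdot p p * vdot q q)
    by (rewrite <- (vnorm_sqr p), <- (vnorm_sqr q); ring).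
  enough (0 <= vdot (vcross p q) (vcross p q)) by
    (replace (vdot p p * vdot q q) with (vdot p q * vdot p q + vdot (vcross p q) (vcross p q)); [lra|v3ring]).
  apply vdot_self_ge0.
Qed.

Lemma vnorm_add_le p q : vnorm (vadd p q) <= vnorm p + vnorm q.
Proof.
  apply Rsqr_incr_0_var; [unfold Rsqr|pose proof (vnorm_ge0 p); pose proof (vnorm_ge0 q); lra].
  rewrite vnorm_sqr.
  replace (vdot (vadd p q) (vadd p q)) with (vdot p p + 2 * vdot p q + vdot q q) by v3ring.
  rewrite <- (vnorm_sqr p), <- (vnorm_sqr q).
  pose proof (Rabs_vdot_le p q); pose proof (Rle_abs (vdot p q)); nra.
Qed.

Lemma vnorm_scale a p : vnorm (vscale a p) = Rabs a * vnorm p.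
Proof.
  unfold vnorm.
  replace (vdot (vscale a p) (vscale a p)) with (Rsqr a * vdot p p) by (unfold Rsqr; v3ring).
  rewrite sqrt_mult by (auto using Rle_0_sqr, vdot_self_ge0).
  now rewrite sqrt_Rsqr_abs.
Qed.

Lemma vnorm_subC p q : vnorm (vsub p q) = vnorm (vsub q p).
Proof. unfold vnorm; f_equal; v3ring. Qed.

Lemma vnorm_sub_triangle p q r : vnorm (vsub p r) <= vnorm (vsub p q) + vnorm (vsub q r).
Proof.
  replace (vsub p r) with (vadd (vsub p q) (vsub q r)) by v3ring.
  apply vnorm_add_le.
Qed.

Lemma vdot_self_eq0 p : vdot p p = 0 -> p = (0, 0, 0).
Proof.
  destruct p as [[x y] z]; v3unfold; intros H.
  assert (x = 0) by nra; assert (y = 0) by nra; assert (z = 0) by nra; now subst.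
Qed.

Lemma vnorm_le_of_sqr p a : 0 <= a -> vdot p p <= a * a -> vnorm p <= a.
Proof. intros Ha H; apply Rsqr_incr_0_var; auto; unfold Rsqr; now rewrite vnorm_sqr. Qed.

Lemma vnorm_le_coord p : vnorm p <= Rabs (vx p) + Rabs (vy p) + Rabs (vz p).
Proof.
  pose proof (Rabs_pos (vx p)); pose proof (Rabs_pos (vy p)); pose proof (Rabs_pos (vz p)).
  apply vnorm_le_of_sqr; [lra|].
  unfold vdot.
  rewrite <- (Rabs_pos_eq (vx p * vx p)), <- (Rabs_pos_eq (vy p * vy p)), <- (Rabs_pos_eq (vz p * vz p)) by nra.
  rewrite !Rabs_mult; nra.
Qed.

(* Expanding T p - T 0 in the orthonormal image of the standard basis. *)
Lemma isometry3_affine T : isometry3 T ->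
  exists f1 f2 f3, forall p u,
    vsub (T (vadd p u)) (T p)
    = vadd (vadd (vscale (vx u) f1) (vscale (vy u) f2)) (vscale (vz u) f3).
Proof.
  intros HT.
  set (o := (0, 0, 0)); set (U := fun p => vsub (T p) (T o)).
  assert (Hd : forall p q, vdot (U p) (U q) = vdot p q).
  { assert (Hs : forall p q, vdot (vsub (T p) (T q)) (vsub (T p) (T q)) = vdot (vsub p q) (vsub p q)).
    { intros p q; rewrite <- !vnorm_sqr; fold (dist3 (T p) (T q)); fold (dist3 p q); now rewrite HT. }
    intros p q; unfold U.
    pose proof (Hs p q) as H1; pose proof (Hs p o) as H2; pose proof (Hs q o) as H3.
    replace (vdot (vsub (T p) (T o)) (vsub (T q) (T o))) with
      ((vdot (vsub (T p) (T o)) (vsub (T p) (T o)) + vdot (vsub (T q) (T o)) (vsub (T q) (T o))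
        - vdot (vsub (T p) (T q)) (vsub (T p) (T q))) / 2) by (v3unfold; field).
    rewrite H1, H2, H3; unfold o; v3unfold; field. }
  set (f1 := U (1, 0, 0)); set (f2 := U (0, 1, 0)); set (f3 := U (0, 0, 1)).
  assert (HU : forall p, U p = vadd (vadd (vscale (vx p) f1) (vscale (vy p) f2)) (vscale (vz p) f3)).
  { intros p.
    set (w := vadd (vadd (vscale (vx p) f1) (vscale (vy p) f2)) (vscale (vz p) f3)).
    assert (H0 : vsub (U p) w = o).
    { apply vdot_self_eq0.
      replace (vdot (vsub (U p) w) (vsub (U p) w)) with
        (vdot (U p) (U p) - 2 * (vx p * vdot (U p) f1 + vy p * vdot (U p) f2 + vz p * vdot (U p) f3)
         + (vx p * vx p * vdot f1 f1 + vy p * vy p * vdot f2 f2 + vz p * vz p * vdot f3 f3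
         + 2 * (vx p * vy p * vdot f1 f2 + vx p * vz p * vdot f1 f3 + vy p * vz p * vdot f2 f3)))
        by (unfold w; v3ring).
      unfold f1, f2, f3; rewrite !Hd; v3unfold; ring. }
    replace (U p) with (vadd (vsub (U p) w) w) by v3ring.
    rewrite H0; unfold o; destruct w as [[? ?] ?]; v3ring. }
  exists f1, f2, f3; intros p u.
  replace (vsub (T (vadd p u)) (T p)) with (vsub (U (vadd p u)) (U p)) by (unfold U; v3ring).
  rewrite !HU; v3ring.
Qed.

(** * Derivatives of space curves *)

Lemma Dr_eq f x l : derivable_pt_lim f x l -> Dr f x = l.
Proof.
  intros H; unfold Dr.
  apply (uniqueness_limite f x); [apply epsilon_spec; now exists l|exact H].
Qed.

(** Relational form of the derivative, which asserts differentiability. The classically chosen [Dv]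
    carries information only through [Dv_eq]. *)
Definition vderiv (s : R -> V3) (t : R) (w : V3) : Prop :=
  derivable_pt_lim (fun u => vx (s u)) t (vx w) /\
  derivable_pt_lim (fun u => vy (s u)) t (vy w) /\
  derivable_pt_lim (fun u => vz (s u)) t (vz w).

Lemma Dv_eq s t w : vderiv s t w -> Dv s t = w.
Proof.
  intros (H1 & H2 & H3); unfold Dv.
  rewrite (Dr_eq _ _ _ H1), (Dr_eq _ _ _ H2), (Dr_eq _ _ _ H3).
  destruct w as [[? ?] ?]; reflexivity.
Qed.

Lemma vderiv_dot s t w u : vderiv s t w -> derivable_pt_lim (fun x => vdot u (s x)) t (vdot u w).
Proof.
  intros (H1 & H2 & H3); unfold vdot.
  apply (derivable_pt_lim_plus (fun x => vx u * vx (s x) + vy u * vy (s x)));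
    [apply (derivable_pt_lim_plus (fun x => vx u * vx (s x)))|];
    now apply (derivable_pt_lim_scal (fun x => _)).
Qed.

(** * The curve c0 and its Frenet frame *)

Definition e0 (t : R) : V3 := (/ (1 + t ^ 2), sqrt 2 * t / (1 + t ^ 2), t ^ 2 / (1 + t ^ 2)).
Definition n0 (t : R) : V3 :=
  (- (sqrt 2 * t / (1 + t ^ 2)), (1 - t ^ 2) / (1 + t ^ 2), sqrt 2 * t / (1 + t ^ 2)).
Definition b0 (t : R) : V3 := (t ^ 2 / (1 + t ^ 2), - (sqrt 2 * t / (1 + t ^ 2)), / (1 + t ^ 2)).
Definition kappa0 (t : R) : R := sqrt 2 / (1 + t ^ 2).

Lemma one_plus_sqr_gt0 t : 0 < 1 + t ^ 2.
Proof. nra. Qed.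

Lemma sqrt2_sqr : sqrt 2 * sqrt 2 = 2.
Proof. apply sqrt_sqrt; lra. Qed.

Lemma sqrt2_gt0 : 0 < sqrt 2.
Proof. apply sqrt_lt_R0; lra. Qed.

Lemma kappa0_gt0 t : 0 < kappa0 t.
Proof. apply Rdiv_lt_0_compat; [apply sqrt2_gt0|apply one_plus_sqr_gt0]. Qed.

Ltac derivR :=
  apply is_derive_Reals; auto_derive; [repeat split; nra|];
  pose proof sqrt2_gt0; field [sqrt2_sqr]; repeat split; nra.

Lemma c0_deriv t : vderiv c0 t (e0 t).
Proof. repeat split; cbn; derivR. Qed.

Lemma e0_deriv t : vderiv e0 t (vscale (kappa0 t) (n0 t)).
Proof. repeat split; cbn; unfold kappa0; derivR. Qed.

(** The Frenet equation for the normal. The equal coefficients of [b0] and [- e0] express that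
    torsion and curvature coincide. *)
Lemma n0_deriv t : vderiv n0 t (vscale (kappa0 t) (vsub (b0 t) (e0 t))).
Proof. repeat split; cbn; unfold kappa0; derivR. Qed.

Lemma frame0 t :
  vdot (e0 t) (e0 t) = 1 /\ vdot (n0 t) (n0 t) = 1 /\ vdot (b0 t) (b0 t) = 1 /\
  vdot (e0 t) (n0 t) = 0 /\ vdot (e0 t) (b0 t) = 0 /\ vdot (n0 t) (b0 t) = 0.
Proof.
  pose proof sqrt2_gt0.
  repeat split; v3unfold; unfold e0, n0, b0; cbn [fst snd]; field [sqrt2_sqr]; nra.
Qed.

Lemma cross_e0_n0 t : vcross (e0 t) (n0 t) = b0 t.
Proof.
  pose proof sqrt2_gt0.
  unfold e0, n0, b0; v3unfold; repeat apply f_equal2; field [sqrt2_sqr]; nra.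
Qed.

Lemma vnorm_unit p : vdot p p = 1 -> vnorm p = 1.
Proof. unfold vnorm; intros ->; apply sqrt_1. Qed.

Lemma tangent_c0 : tangent c0 = e0.
Proof. extensionality t; apply Dv_eq, c0_deriv. Qed.

Lemma Dv_Dv_c0 t : Dv (Dv c0) t = vscale (kappa0 t) (n0 t).
Proof. change (Dv c0) with (tangent c0); rewrite tangent_c0; apply Dv_eq, e0_deriv. Qed.

Lemma curvature_c0 : curvature c0 = kappa0.
Proof.
  extensionality t; unfold curvature; rewrite Dv_Dv_c0, vnorm_scale, vnorm_unit by apply frame0.
  rewrite Rabs_pos_eq by (apply Rlt_le, kappa0_gt0); ring.
Qed.

Lemma vscale_inv_l k p : k <> 0 -> vscale (/ k) (vscale k p) = p.
Proof. intros; destruct p as [[? ?] ?]; v3unfold; repeat apply f_equal2; now field. Qed.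

Lemma normal_c0 : normal c0 = n0.
Proof.
  extensionality t; unfold normal; rewrite curvature_c0, Dv_Dv_c0.
  apply vscale_inv_l; pose proof (kappa0_gt0 t); lra.
Qed.

Lemma binormal_c0 : binormal c0 = b0.
Proof. extensionality t; unfold binormal; rewrite tangent_c0, normal_c0; apply cross_e0_n0. Qed.

Lemma torsion_c0 : torsion c0 = kappa0.
Proof.
  extensionality t; unfold torsion; rewrite normal_c0, binormal_c0, (Dv_eq _ _ _ (n0_deriv t)).
  destruct (frame0 t) as (_ & _ & Hb & _ & He & _).
  replace (vdot _ _) with (kappa0 t * (vdot (b0 t) (b0 t) - vdot (e0 t) (b0 t))) by v3ring.
  rewrite Hb, He; ring.
Qed.

(** * Frenet data of the reversed curve *)

(** The factor [a] makes the lemma iterable. Each differentiation contributes one sign, so reversal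
    flips the tangent, keeps the second derivative and the normal, and hence flips the binormal and
    keeps the torsion. *)
Lemma vderiv_reverse s t w a : vderiv s (1 - t) w ->
  vderiv (fun u => vscale a (s (1 - u))) t (vscale (- a) w).
Proof.
  assert (H : forall f l, derivable_pt_lim f (1 - t) l ->
            derivable_pt_lim (fun u => a * f (1 - u)) t (- a * l)).
  { intros f l Hf; replace (- a * l) with (a * (l * (-1))) by ring.
    apply (derivable_pt_lim_scal (fun u => f (1 - u))).
    apply (derivable_pt_lim_comp (fun u => 1 - u) f); [|exact Hf].
    apply is_derive_Reals; auto_derive; auto; ring. }
  intros (H1 & H2 & H3); repeat split; cbn [vscale vx vy vz fst snd].
  - exact (H (fun u => vx (s u)) _ H1).
  - exact (H (fun u => vy (s u)) _ H2).
  - exact (H (fun u => vz (s u)) _ H3).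
Qed.

Lemma vscale_1 p : vscale 1 p = p.
Proof. destruct p as [[? ?] ?]; v3ring. Qed.

Lemma c0sharp_deriv t : vderiv c0sharp t (vscale (-1) (e0 (1 - t))).
Proof.
  replace c0sharp with (fun u => vscale 1 (c0 (1 - u)))
    by (extensionality u; apply vscale_1).
  apply vderiv_reverse, c0_deriv.
Qed.

Lemma tangent_c0sharp : tangent c0sharp = fun t => vscale (-1) (e0 (1 - t)).
Proof. extensionality t; apply Dv_eq, c0sharp_deriv. Qed.

Lemma Dv_Dv_c0sharp t : Dv (Dv c0sharp) t = vscale (kappa0 (1 - t)) (n0 (1 - t)).
Proof.
  change (Dv c0sharp) with (tangent c0sharp); rewrite tangent_c0sharp.
  apply Dv_eq; replace (vscale (kappa0 (1 - t)) (n0 (1 - t)))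
    with (vscale (- -1) (vscale (kappa0 (1 - t)) (n0 (1 - t)))) by v3ring.
  apply vderiv_reverse, e0_deriv.
Qed.

Lemma curvature_c0sharp : curvature c0sharp = fun t => kappa0 (1 - t).
Proof.
  extensionality t; unfold curvature; rewrite Dv_Dv_c0sharp, vnorm_scale, vnorm_unit by apply frame0.
  rewrite Rabs_pos_eq by (apply Rlt_le, kappa0_gt0); ring.
Qed.

Lemma normal_c0sharp : normal c0sharp = fun t => n0 (1 - t).
Proof.
  extensionality t; unfold normal; rewrite curvature_c0sharp, Dv_Dv_c0sharp.
  apply vscale_inv_l; pose proof (kappa0_gt0 (1 - t)); lra.
Qed.

Lemma binormal_c0sharp : binormal c0sharp = fun t => vscale (-1) (b0 (1 - t)).
Proof.
  extensionality t; unfold binormal; rewrite tangent_c0sharp, normal_c0sharp, <- cross_e0_n0; v3ring.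
Qed.

Lemma torsion_c0sharp : torsion c0sharp = fun t => kappa0 (1 - t).
Proof.
  extensionality t; unfold torsion; rewrite normal_c0sharp, binormal_c0sharp.
  replace (fun t0 => n0 (1 - t0)) with (fun u => vscale 1 (n0 (1 - u)))
    by (extensionality u; apply vscale_1).
  rewrite (Dv_eq _ _ _ (vderiv_reverse _ _ _ 1 (n0_deriv (1 - t)))).
  destruct (frame0 (1 - t)) as (_ & _ & Hb & _ & He & _).
  replace (vdot _ _) with
    (kappa0 (1 - t) * (vdot (b0 (1 - t)) (b0 (1 - t)) - vdot (e0 (1 - t)) (b0 (1 - t)))) by v3ring.
  rewrite Hb, He; ring.
Qed.

(** * Chord lengths of c0 *)

Definition I0 (t : R) : Prop := 1/10 <= t <= 9/10.

(** The mean value theorem has no exact vector form, so it is applied to the component along [w];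
    the intermediate point depends on [w]. *)
Lemma c0_mvt_strict w s t : s < t ->
  exists x, s < x < t /\ vdot w (vsub (c0 t) (c0 s)) = (t - s) * vdot w (e0 x).
Proof.
  intros Hst.
  destruct (MVT_cor2 (fun u => vdot w (c0 u)) (fun u => vdot w (e0 u)) s t Hst) as (x & Hx & Hx').
  { intros u _; apply vderiv_dot, c0_deriv. }
  exists x; split; [lra|].
  replace (vdot w (vsub (c0 t) (c0 s))) with (vdot w (c0 t) - vdot w (c0 s)) by v3ring.
  rewrite Hx; ring.
Qed.

Lemma c0_mvt w s t : s <= t ->
  exists x, s <= x <= t /\ vdot w (vsub (c0 t) (c0 s)) = (t - s) * vdot w (e0 x).
Proof.
  intros [Hst| ->].
  - destruct (c0_mvt_strict w s t Hst) as (x & Hx & E); exists x; split; [lra|exact E].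
  - exists t; split; [lra|v3ring].
Qed.

(** The right side is the squared cosine of [atan x - atan y]. *)
Lemma e0_dot x y : vdot (e0 x) (e0 y) = (1 + x * y) ^ 2 / ((1 + x ^ 2) * (1 + y ^ 2)).
Proof.
  v3unfold; unfold e0; cbn [fst snd]; field [sqrt2_sqr]; split; nra.
Qed.

(** The denominator in [e0_dot] is [(1 + x * y)^2 + (x - y)^2], where on the parameter interval the
    first square is at least 1.01^2 and the second at most 0.8^2. Thus the tangents turn little
    enough for chords to behave almost like segments of a line. *)
Lemma e0_dot_bounds x y : I0 x -> I0 y -> 3/5 <= vdot (e0 x) (e0 y) <= 1.
Proof.
  unfold I0; intros Hx Hy; rewrite e0_dot.
  assert (Hp : 0 < (1 + x ^ 2) * (1 + y ^ 2)) by (apply Rmult_lt_0_compat; nra).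
  assert (He : (1 + x ^ 2) * (1 + y ^ 2) = (1 + x * y) ^ 2 + (x - y) ^ 2) by ring.
  split.
  - apply (proj1 (Rle_div_r (3/5) _ _ Hp)); rewrite He.
    assert ((x - y) ^ 2 <= (8/10) ^ 2) by nra.
    assert (1/100 <= x * y) by nra. nra.
  - apply (proj2 (Rle_div_l _ _ _ Hp)); rewrite He; pose proof (pow2_ge_0 (x - y)); lra.
Qed.

(** Using the mean value theorem once in each chord turns the product of two chords into the product
    of two tangents, times both parameter lengths. All later comparisons of chords rest on these two
    bounds. *)
Lemma chord_dot s t u w : I0 s -> I0 t -> I0 u -> I0 w -> s <= t -> u <= w ->
  3/5 * ((t - s) * (w - u)) <= vdot (vsub (c0 t) (c0 s)) (vsub (c0 w) (c0 u)) <= (t - s) * (w - u).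
Proof.
  unfold I0; intros Hs Ht Hu Hw Hst Huw.
  destruct (c0_mvt (vsub (c0 t) (c0 s)) u w Huw) as (y & Hy & ->).
  rewrite vdotC.
  destruct (c0_mvt (e0 y) s t Hst) as (x & Hx & ->).
  assert (HB : 3/5 <= vdot (e0 y) (e0 x) <= 1) by (apply e0_dot_bounds; unfold I0; lra).
  assert (0 <= (t - s) * (w - u)) by nra.
  nra.
Qed.

Definition chord (s t : R) : R := vnorm (vsub (c0 t) (c0 s)).

Lemma chordC s t : chord s t = chord t s.
Proof. apply vnorm_subC. Qed.

Lemma chord_ge0 s t : 0 <= chord s t.
Proof. apply vnorm_ge0. Qed.

Lemma chord_triangle s t u : chord s u <= chord s t + chord t u.
Proof. rewrite (chordC s u), (chordC s t), (chordC t u). unfold chord.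
  pose proof (vnorm_sub_triangle (c0 s) (c0 t) (c0 u)); lra. Qed.

Lemma chord_sqr s t : chord s t * chord s t = vdot (vsub (c0 t) (c0 s)) (vsub (c0 t) (c0 s)).
Proof. apply vnorm_sqr. Qed.

Lemma chord_le s t : I0 s -> I0 t -> s <= t -> chord s t <= t - s.
Proof.
  intros Hs Ht Hst.
  pose proof (chord_dot s t s t Hs Ht Hs Ht Hst Hst).
  apply vnorm_le_of_sqr; [lra|tauto].
Qed.

(** The constant 4/3 is a rational upper bound for the inverse square root of 3/5. *)
Lemma chord_ge s t : I0 s -> I0 t -> Rabs (t - s) <= 4/3 * chord s t.
Proof.
  assert (H : forall s t, I0 s -> I0 t -> s <= t -> t - s <= 4/3 * chord s t).
  { intros s' t' Hs Ht Hst.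
    pose proof (chord_dot s' t' s' t' Hs Ht Hs Ht Hst Hst) as HD.
    rewrite <- chord_sqr in HD; pose proof (chord_ge0 s' t'); nra. }
  intros Hs Ht; destruct (Rle_dec s t).
  - rewrite Rabs_pos_eq by lra; auto.
  - rewrite Rabs_left1 by lra; rewrite chordC, Ropp_minus_distr; apply H; auto; lra.
Qed.

(** The distance to the left end grows at rate at least 3/10. The difference of the squared
    distances to parameters [t <= g] is at least [3/5 * (g - t) * (g - 1/10)], and the sum of the
    distances is at most [2 * (g - 1/10)]. *)
Lemma chord_left_separates t g h : I0 t -> I0 g ->
  Rabs (chord (1/10) g - chord (1/10) t) <= h -> Rabs (g - t) <= 10/3 * h.
Proof.
  assert (H : forall t g, I0 t -> I0 g -> t <= g ->
            Rabs (chord (1/10) g - chord (1/10) t) <= h -> g - t <= 10/3 * h).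
  { intros t' g' Ht Hg Htg Hh.
    assert (Ha : I0 (1/10)) by (unfold I0; lra).
    assert (Ht' : 1/10 <= t') by apply Ht; assert (Hg' : 1/10 <= g') by apply Hg.
    pose proof (chord_dot t' g' (1/10) g' Ht Hg Ha Hg Htg Hg') as H1.
    pose proof (chord_dot t' g' (1/10) t' Ht Hg Ha Ht Htg Ht') as H2.
    pose proof (chord_le _ _ Ha Ht Ht'); pose proof (chord_le _ _ Ha Hg Hg').
    pose proof (chord_ge0 (1/10) t'); pose proof (chord_ge0 (1/10) g').
    assert (HE : chord (1/10) g' * chord (1/10) g' - chord (1/10) t' * chord (1/10) t' =
      vdot (vsub (c0 g') (c0 t')) (vsub (c0 g') (c0 (1/10))) +
      vdot (vsub (c0 g') (c0 t')) (vsub (c0 t') (c0 (1/10)))) by (rewrite !chord_sqr; v3ring).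
    apply Rabs_le_between in Hh.
    set (G := chord (1/10) g') in *; set (U := chord (1/10) t') in *.
    assert (0 <= (g' - t') * (t' - 1/10)) by nra.
    assert (3/5 * ((g' - t') * (g' - 1/10)) <= h * (2 * (g' - 1/10))).
    { apply Rle_trans with ((G - U) * (G + U)); [nra|].
      apply Rle_trans with (h * (G + U)); [apply Rmult_le_compat_r; lra|].
      apply Rmult_le_compat_l; lra. }
    (* The common factor [g' - 1/10] can be cancelled unless it vanishes, and then [t'] is the left
       end too. *)
    destruct (Req_dec g' (1/10)) as [->|Hne]; [lra|].
    apply Rmult_le_reg_r with (g' - 1/10); [lra|]. nra. }
  intros Ht Hg Hh; destruct (Rle_dec t g).
  - rewrite Rabs_pos_eq by lra; auto.
  - rewrite Rabs_left1 by lra; rewrite Ropp_minus_distr; apply H; auto; [lra|].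
    now rewrite Rabs_minus_sym.
Qed.

(** The squared lengths of the full chord and of the chord from [u] to [w] differ by the product of
    the cut-off pieces with the sum of both chords, at least [3/5 * 8/10] times the total cut-off
    parameter. Dividing by the sum of the lengths, at most 16/10, gives the factor 10/3, rounded up
    to 7/2. *)
Lemma long_chord_ends u w h : I0 u -> I0 w -> u <= w ->
  chord (1/10) (9/10) - h <= chord u w -> 0 <= h ->
  (u - 1/10) + (9/10 - w) <= 7/2 * h.
Proof.
  intros Hu Hw Huw Hh Hh0.
  assert (Ha : I0 (1/10)) by (unfold I0; lra); assert (Hz : I0 (9/10)) by (unfold I0; lra).
  assert (Hu' : 1/10 <= u) by apply Hu; assert (Hw' : w <= 9/10) by apply Hw.
  assert (Haz : 1/10 <= 9/10) by lra.
  pose proof (chord_dot _ _ _ _ Ha Hu Ha Hz Hu' Haz).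
  pose proof (chord_dot _ _ _ _ Hw Hz Ha Hz Hw' Haz).
  pose proof (chord_dot _ _ _ _ Ha Hu Hu Hw Hu' Huw).
  pose proof (chord_dot _ _ _ _ Hw Hz Hu Hw Hw' Huw).
  pose proof (chord_le _ _ Ha Hz Haz); pose proof (chord_le _ _ Hu Hw Huw).
  pose proof (chord_ge0 u w); pose proof (chord_ge0 (1/10) (9/10)).
  assert (HE : chord (1/10) (9/10) * chord (1/10) (9/10) - chord u w * chord u w =
    vdot (vsub (c0 u) (c0 (1/10))) (vsub (c0 (9/10)) (c0 (1/10))) +
    vdot (vsub (c0 (9/10)) (c0 w)) (vsub (c0 (9/10)) (c0 (1/10))) +
    vdot (vsub (c0 u) (c0 (1/10))) (vsub (c0 w) (c0 u)) +
    vdot (vsub (c0 (9/10)) (c0 w)) (vsub (c0 w) (c0 u))) by (rewrite !chord_sqr; v3ring).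
  set (W := chord (1/10) (9/10)) in *; set (B := chord u w) in *.
  assert (0 <= (u - 1/10) * (w - u)) by nra.
  assert (0 <= (9/10 - w) * (w - u)) by nra.
  assert ((W - B) * (W + B) <= h * (16/10)).
  { apply Rle_trans with (h * (W + B)); [apply Rmult_le_compat_r; lra|].
    apply Rmult_le_compat_l; lra. }
  nra.
Qed.

(** * Numerical bounds for arctangents, logarithms and chords *)

Lemma le_of_deriv_nonneg f f' x : 0 <= x -> f 0 = 0 ->
  (forall u, 0 <= u <= x -> derivable_pt_lim f u (f' u)) ->
  (forall u, 0 <= u <= x -> 0 <= f' u) -> 0 <= f x.
Proof.
  intros [Hx| <-] H0 Hd Hp; [|lra].
  destruct (MVT_cor2 f f' 0 x Hx Hd) as (c & Hc & Hc').
  specialize (Hp c ltac:(lra)); nra.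
Qed.

Lemma atan_ge_taylor7 x : 0 <= x -> x - x^3/3 + x^5/5 - x^7/7 <= atan x.
Proof.
  intros Hx; apply Rminus_le_0.
  apply (le_of_deriv_nonneg (fun u => atan u - (u - u^3/3 + u^5/5 - u^7/7)) (fun u => u^8 / (1 + u^2))); auto.
  - rewrite atan_0; lra.
  - intros u _; apply is_derive_Reals; auto_derive; [auto|field; nra].
  - intros u _; apply Rle_mult_inv_pos; [|nra]. replace (u^8) with ((u^4)^2) by ring; apply pow2_ge_0.
Qed.

Lemma atan_le_taylor9 x : 0 <= x -> atan x <= x - x^3/3 + x^5/5 - x^7/7 + x^9/9.
Proof.
  intros Hx; apply Rminus_le_0.
  apply (le_of_deriv_nonneg (fun u => (u - u^3/3 + u^5/5 - u^7/7 + u^9/9) - atan u) (fun u => u^10 / (1 + u^2))); auto.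
  - rewrite atan_0; lra.
  - intros u _; apply is_derive_Reals; auto_derive; [auto|field; nra].
  - intros u _; apply Rle_mult_inv_pos; [|nra]. replace (u^10) with ((u^5)^2) by ring; apply pow2_ge_0.
Qed.

Lemma ln_ratio_ge x : 0 <= x < 1 -> 2 * (x + x^3/3) <= ln (1 + x) - ln (1 - x).
Proof.
  intros Hx; apply Rminus_le_0.
  apply (le_of_deriv_nonneg (fun u => ln (1 + u) - ln (1 - u) - 2 * (u + u^3/3)) (fun u => 2 * u^4 / (1 - u^2))); try lra.
  - rewrite Rplus_0_r, Rminus_0_r, ln_1; lra.
  - intros u Hu; apply is_derive_Reals; auto_derive; [repeat split; lra|field; repeat split; nra].
  - intros u Hu; apply Rle_mult_inv_pos; [|nra]. replace (u^4) with ((u^2)^2) by ring; pose proof (pow2_ge_0 (u^2)); lra.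
Qed.

(** The coefficient 4/15 comes from integrating [1 / (1 - u^2) <= 1 + u^2 + 4/3 * u^4], which holds
    exactly up to [u = 1/2] because there [1 / (1 - u^2)] is at most 4/3. *)
Lemma ln_ratio_le x : 0 <= x <= 1/2 -> ln (1 + x) - ln (1 - x) <= 2 * (x + x^3/3 + 4 * x^5/15).
Proof.
  intros Hx; apply Rminus_le_0.
  apply (le_of_deriv_nonneg (fun u => 2 * (u + u^3/3 + 4 * u^5/15) - (ln (1 + u) - ln (1 - u)))
    (fun u => 2 * u^4 * (1/3 - 4/3 * u^2) / (1 - u^2))); try lra.
  - rewrite Rplus_0_r, Rminus_0_r, ln_1; lra.
  - intros u Hu; apply is_derive_Reals; auto_derive; [repeat split; lra|field; repeat split; nra].
  - intros u Hu; apply Rle_mult_inv_pos; [|nra]. replace (u^4) with ((u^2)^2) by ring; pose proof (pow2_ge_0 (u^2)).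
    apply Rmult_le_pos; nra.
Qed.

Lemma atan_diff s t : 0 < s -> s < t < 1 -> atan t - atan s = atan ((t - s) / (1 + s * t)).
Proof.
  intros Hs Ht.
  assert (0 < atan s) by (rewrite <- atan_0; apply atan_increasing; lra).
  assert (atan s < atan t) by (apply atan_increasing; lra).
  assert (atan t < PI/4) by (rewrite <- atan_1; apply atan_increasing; lra).
  rewrite <- (atan_tan (atan t - atan s)) by (pose proof PI_RGT_0; split; lra).
  f_equal; rewrite tan_minus, !tan_atan; [f_equal; ring| | | |].
  all: try (apply Rgt_not_eq, cos_gt_0; pose proof PI_RGT_0; lra).
  rewrite !tan_atan; nra.
Qed.

(** Brings a difference of logarithms into the form bounded by [ln_ratio_ge] and [ln_ratio_le], with
    an argument small enough for short polynomials to be sharp. *)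
Lemma ln_diff s t : 0 < s -> s < t ->
  ln t - ln s = ln (1 + (t - s) / (t + s)) - ln (1 - (t - s) / (t + s)).
Proof.
  intros Hs Hst.
  replace (1 + (t - s) / (t + s)) with (t * (2 / (t + s))) by (field; lra).
  replace (1 - (t - s) / (t + s)) with (s * (2 / (t + s))) by (field; lra).
  assert (0 < 2 / (t + s)) by (apply Rdiv_lt_0_compat; lra).
  rewrite !ln_mult by lra; ring.
Qed.

Lemma chord_sqr_explicit s t : chord s t * chord s t =
  (atan t - atan s) ^ 2 + (ln (1 + t ^ 2) - ln (1 + s ^ 2)) ^ 2 / 2 + (t - s - (atan t - atan s)) ^ 2.
Proof.
  rewrite chord_sqr; v3unfold; unfold c0; cbn [fst snd].
  pose proof sqrt2_gt0; field [sqrt2_sqr]; lra.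
Qed.

(** The function [p^2 + (t - s - p)^2] increases once [p >= (t - s) / 2], so under that condition a
    bound for the arctangent difference may replace it in [chord_sqr_explicit]. *)
Lemma chord_ge_rational s t p q r : 0 <= r -> 
  (t - s) / 2 <= p <= atan t - atan s -> 0 <= q <= ln (1 + t ^ 2) - ln (1 + s ^ 2) ->
  r * r <= p ^ 2 + q ^ 2 / 2 + (t - s - p) ^ 2 -> r <= chord s t.
Proof.
  intros Hr Hp Hq H; apply Rsqr_incr_0_var; [unfold Rsqr|apply chord_ge0].
  rewrite chord_sqr_explicit; nra.
Qed.

Lemma chord_le_rational s t p q r : 0 <= r ->
  (t - s) / 2 <= atan t - atan s <= p -> 0 <= ln (1 + t ^ 2) - ln (1 + s ^ 2) <= q ->
  p ^ 2 + q ^ 2 / 2 + (t - s - p) ^ 2 <= r * r -> chord s t <= r.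
Proof.
  intros Hr Hp Hq H; apply Rsqr_incr_0_var; [unfold Rsqr|exact Hr].
  rewrite chord_sqr_explicit; nra.
Qed.

(* The arc curves more at its left end, so reversing it cannot preserve these chords. *)
Lemma chord_asymmetry :
  chord (1/10) (7/10) + 2/10 + 1/1000 <= chord (3/10) (9/10) + chord (1/10) (3/10).
Proof.
  (* The three decimal bounds suffice by a small margin: 0.5899 + 0.1990 exceeds 0.5876 + 0.2010 by
     0.0003. The witnesses are rounded values of the arctangent and logarithm differences. *)
  assert (H1 : 5899/10000 <= chord (3/10) (9/10)).
  { apply chord_ge_rational with (4411/10000) (5066/10000); try lra.
    - rewrite atan_diff by lra. pose proof (atan_ge_taylor7 ((9/10 - 3/10) / (1 + 3/10 * (9/10))) ltac:(lra)) as H; lra.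
    - rewrite ln_diff by lra.
      pose proof (ln_ratio_ge ((1 + (9/10)^2 - (1 + (3/10)^2)) / (1 + (9/10)^2 + (1 + (3/10)^2))) ltac:(lra)) as H; lra. }
  assert (H2 : 1990/10000 <= chord (1/10) (3/10)).
  { apply chord_ge_rational with (1916/10000) (759/10000); try lra.
    - rewrite atan_diff by lra. pose proof (atan_ge_taylor7 ((3/10 - 1/10) / (1 + 1/10 * (3/10))) ltac:(lra)) as H; lra.
    - rewrite ln_diff by lra.
      pose proof (ln_ratio_ge ((1 + (3/10)^2 - (1 + (1/10)^2)) / (1 + (3/10)^2 + (1 + (1/10)^2))) ltac:(lra)) as H; lra. }
  assert (H3 : chord (1/10) (7/10) <= 5876/10000).
  { apply chord_le_rational with (5112/10000) (3890/10000); try lra.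
    - rewrite atan_diff by lra. pose proof (atan_le_taylor9 ((7/10 - 1/10) / (1 + 1/10 * (7/10))) ltac:(lra)) as H.
      pose proof (atan_ge_taylor7 ((7/10 - 1/10) / (1 + 1/10 * (7/10))) ltac:(lra)) as H'; lra.
    - rewrite ln_diff by lra.
      pose proof (ln_ratio_ge ((1 + (7/10)^2 - (1 + (1/10)^2)) / (1 + (7/10)^2 + (1 + (1/10)^2))) ltac:(lra)) as H.
      pose proof (ln_ratio_le ((1 + (7/10)^2 - (1 + (1/10)^2)) / (1 + (7/10)^2 + (1 + (1/10)^2))) ltac:(lra)) as H'; lra. }
  lra.
Qed.

(** * Isometries almost preserving the crease *)

Definition det3 (u v w : V3) : R := vdot u (vcross v w).

(** Cramer's rule: [det3 u v w] times [x] is the combination of the cross products of [u], [v], [w]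
    whose coefficients are the products of [x] with these vectors. *)
Lemma det3_control u v w : det3 u v w <> 0 ->
  exists K, 0 <= K /\ forall x h,
    Rabs (vdot x u) <= h -> Rabs (vdot x v) <= h -> Rabs (vdot x w) <= h -> vnorm x <= K * h.
Proof.
  intros Hd.
  set (K := (vnorm (vcross v w) + vnorm (vcross w u) + vnorm (vcross u v)) / Rabs (det3 u v w)).
  assert (Hp : 0 < Rabs (det3 u v w)) by now apply Rabs_pos_lt.
  assert (HK : K * Rabs (det3 u v w) = vnorm (vcross v w) + vnorm (vcross w u) + vnorm (vcross u v))
    by (unfold K; field; lra).
  pose proof (vnorm_ge0 (vcross v w)); pose proof (vnorm_ge0 (vcross w u)); pose proof (vnorm_ge0 (vcross u v)).
  exists K; split; [unfold K; apply Rle_mult_inv_pos; lra|].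
  intros x h B1 B2 B3.
  apply Rmult_le_reg_l with (Rabs (det3 u v w)); [exact Hp|].
  rewrite <- vnorm_scale.
  replace (vscale (det3 u v w) x) with
    (vadd (vadd (vscale (vdot x u) (vcross v w)) (vscale (vdot x v) (vcross w u)))
          (vscale (vdot x w) (vcross u v))) by (unfold det3; v3ring).
  eapply Rle_trans; [apply vnorm_add_le|].
  eapply Rle_trans; [apply Rplus_le_compat_r, vnorm_add_le|].
  rewrite !vnorm_scale.
  replace (Rabs (det3 u v w) * (K * h)) with ((K * Rabs (det3 u v w)) * h) by ring; rewrite HK; nra.
Qed.

(** A Vandermonde determinant, since [e0 t] is proportional to [(1, sqrt 2 * t, t^2)]. *)
Lemma det3_e0 x y z : det3 (e0 x) (e0 y) (e0 z) =
  sqrt 2 * ((y - x) * (z - y) * (z - x)) / ((1 + x^2) * (1 + y^2) * (1 + z^2)).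
Proof. unfold det3; v3unfold; unfold e0; cbn [fst snd]; field; repeat split; nra. Qed.

(** The determinant is linear in each chord, so three uses of the mean value theorem replace the
    chords by tangents at points of three successive intervals; cyclic permutation brings each chord
    in turn into the product. The points are strictly increasing, and [det3_e0] is positive. *)
Lemma det3_chords : det3 (vsub (c0 (3/10)) (c0 (1/10))) (vsub (c0 (5/10)) (c0 (3/10)))
  (vsub (c0 (7/10)) (c0 (5/10))) <> 0.
Proof.
  set (u := vsub (c0 (3/10)) (c0 (1/10))); set (v := vsub (c0 (5/10)) (c0 (3/10)));
  set (w := vsub (c0 (7/10)) (c0 (5/10))).
  replace (det3 u v w) with (vdot (vcross v w) u) by (unfold det3; v3ring).
  destruct (c0_mvt_strict (vcross v w) (1/10) (3/10)) as (x & Hx & Ex); [lra|].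
  fold u in Ex; rewrite Ex.
  replace (vdot (vcross v w) (e0 x)) with (vdot (vcross w (e0 x)) v) by v3ring.
  destruct (c0_mvt_strict (vcross w (e0 x)) (3/10) (5/10)) as (y & Hy & Ey); [lra|].
  fold v in Ey; rewrite Ey.
  replace (vdot (vcross w (e0 x)) (e0 y)) with (vdot (vcross (e0 x) (e0 y)) w) by v3ring.
  destruct (c0_mvt_strict (vcross (e0 x) (e0 y)) (5/10) (7/10)) as (z & Hz & Ez); [lra|].
  fold w in Ez; rewrite Ez.
  replace (vdot (vcross (e0 x) (e0 y)) (e0 z)) with (det3 (e0 x) (e0 y) (e0 z)) by (unfold det3; v3ring).
  assert (0 < det3 (e0 x) (e0 y) (e0 z)); [|nra].
  rewrite det3_e0; apply Rdiv_lt_0_compat.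
  - apply Rmult_lt_0_compat; [apply sqrt2_gt0|].
    repeat apply Rmult_lt_0_compat; lra.
  - repeat apply Rmult_lt_0_compat; apply one_plus_sqr_gt0.
Qed.

Definition near_crease (T : V3 -> V3) (eps : R) : Prop :=
  forall t, I0 t -> exists g, I0 g /\ vnorm (vsub (T (c0 t)) (c0 g)) <= eps.

Lemma isometry_chord T eps s t g h : isometry3 T ->
  vnorm (vsub (T (c0 s)) (c0 g)) <= eps -> vnorm (vsub (T (c0 t)) (c0 h)) <= eps ->
  Rabs (chord g h - chord s t) <= 2 * eps.
Proof.
  intros HT Hg Hh.
  assert (E : chord s t = vnorm (vsub (T (c0 t)) (T (c0 s)))) by (symmetry; apply HT).
  unfold chord at 1; rewrite E.
  pose proof (vnorm_sub_triangle (T (c0 t)) (c0 h) (T (c0 s))).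
  pose proof (vnorm_sub_triangle (c0 h) (c0 g) (T (c0 s))).
  pose proof (vnorm_sub_triangle (c0 h) (T (c0 t)) (c0 g)).
  pose proof (vnorm_sub_triangle (T (c0 t)) (T (c0 s)) (c0 g)).
  rewrite (vnorm_subC (c0 g)) in *; rewrite (vnorm_subC (c0 h) (T (c0 t))) in *.
  apply Rabs_le; lra.
Qed.

Lemma near_crease_fixes_points T eps : isometry3 T -> eps < 1/20000 -> near_crease T eps ->
  forall t, I0 t -> vnorm (vsub (T (c0 t)) (c0 t)) <= 31 * eps.
Proof.
  intros HT He Hn.
  assert (Ia : I0 (1/10)) by (unfold I0; lra); assert (Iz : I0 (9/10)) by (unfold I0; lra).
  assert (I3 : I0 (3/10)) by (unfold I0; lra); assert (I7 : I0 (7/10)) by (unfold I0; lra).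
  destruct (Hn _ Ia) as (g1 & Ig1 & H1); destruct (Hn _ Iz) as (g9 & Ig9 & H9).
  assert (He0 : 0 <= eps) by (eapply Rle_trans; [apply vnorm_ge0|exact H1]).
  pose proof (isometry_chord T eps _ _ _ _ HT H1 H9) as H19; apply Rabs_le_between in H19.
  destruct (Rle_dec g1 g9) as [Hle|Hgt].
  - assert (HK : (g1 - 1/10) + (9/10 - g9) <= 7/2 * (2 * eps)) by (apply long_chord_ends; auto; lra).
    assert (g9 <= 9/10) by apply Ig9; assert (Hg1 : 1/10 <= g1) by apply Ig1.
    pose proof (chord_le _ _ Ia Ig1 Hg1).
    intros t It; destruct (Hn _ It) as (g & Ig & Hg).
    pose proof (isometry_chord T eps _ _ _ _ HT H1 Hg) as H1g; apply Rabs_le_between in H1g.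
    (* The left end moves by at most [7 * eps] along the arc and the isometry changes distances by
       at most [2 * eps], whence [9 * eps]. The final bound adds one more [eps] to
       [10/3 * 9 * eps]. *)
    assert (Hgt : Rabs (g - t) <= 10/3 * (9 * eps)).
    { apply chord_left_separates; auto.
      pose proof (chord_triangle (1/10) g1 g); pose proof (chord_triangle g1 (1/10) g).
      rewrite (chordC g1 (1/10)) in *; apply Rabs_le; lra. }
    assert (chord t g <= 10/3 * (9 * eps)).
    { destruct (Rle_dec t g).
      - pose proof (chord_le t g It Ig r); pose proof (Rle_abs (g - t)); lra.
      - rewrite chordC; pose proof (chord_le g t Ig It ltac:(lra)); pose proof (Rabs_maj2 (g - t)); lra. }
    pose proof (vnorm_sub_triangle (T (c0 t)) (c0 g) (c0 t)); unfold chord in *; lra.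
  (* The ends are exchanged. The image of [c0 (3/10)] is then close to a point [g] with
     [g - 7/10 <= 2/10 - chord (1/10) (3/10)] up to [9 * eps], and its distance to the left end must
     match [chord (3/10) (9/10)] up to [9 * eps]. The total error [18 * eps] is below 1/1000, which
     contradicts [chord_asymmetry]. *)
  - exfalso.
    assert (HK : (g9 - 1/10) + (9/10 - g1) <= 7/2 * (2 * eps))
      by (apply long_chord_ends; auto; [|rewrite (chordC g9)|]; lra).
    assert (Hg1 : g1 <= 9/10) by apply Ig1; assert (Hg9 : 1/10 <= g9) by apply Ig9.
    pose proof (chord_le _ _ Ia Ig9 Hg9); pose proof (chord_le _ _ Ig1 Iz Hg1).
    destruct (Hn _ I3) as (g & Ig & Hg).
    pose proof (isometry_chord T eps _ _ _ _ HT H1 Hg) as H1g; apply Rabs_le_between in H1g.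
    pose proof (isometry_chord T eps _ _ _ _ HT H9 Hg) as H9g; apply Rabs_le_between in H9g.
    assert (Hg' : g <= 9/10) by apply Ig; assert (Hga : 1/10 <= g) by apply Ig.
    pose proof (chord_le _ _ Ig Iz Hg').
    pose proof (chord_triangle g1 (9/10) g); rewrite (chordC (9/10) g) in *.
    pose proof (chord_triangle g9 (1/10) g); rewrite (chordC g9 (1/10)) in *.
    rewrite (chordC (9/10) (3/10)) in *.
    (* The distance to the left end increases up to the parameter 7/10, and beyond it grows at most
       at unit speed. *)
    assert (chord (1/10) g <= chord (1/10) (7/10) + Rmax 0 (g - 7/10)).
    { destruct (Rle_dec g (7/10)) as [H7|H7].
      - apply Rle_trans with (chord (1/10) (7/10)); [|pose proof (Rmax_l 0 (g - 7/10)); lra].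
        apply Rsqr_incr_0_var; [unfold Rsqr|apply chord_ge0]; rewrite !chord_sqr.
        pose proof (chord_dot _ _ _ _ Ig I7 Ia I7 H7 ltac:(lra)).
        pose proof (chord_dot _ _ _ _ Ig I7 Ia Ig H7 Hga).
        assert (0 <= (7/10 - g) * (7/10 - 1/10)) by nra.
        assert (0 <= (7/10 - g) * (g - 1/10)) by nra.
        set (p := vsub (c0 (7/10)) (c0 (1/10))) in *; set (q := vsub (c0 g) (c0 (1/10))) in *.
        replace (vsub (c0 (7/10)) (c0 g)) with (vsub p q) in * by (unfold p, q; v3ring).
        replace (vdot p p) with (vdot q q + vdot (vsub p q) p + vdot (vsub p q) q) by v3ring.
        lra.
      - pose proof (chord_triangle (1/10) (7/10) g).
        pose proof (chord_le _ _ I7 Ig ltac:(lra)); pose proof (Rmax_r 0 (g - 7/10)); lra. }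
    pose proof chord_asymmetry.
    pose proof (chord_le _ _ Ia I3 ltac:(lra)).
    assert (Rmax 0 (g - 7/10) <= 2/10 - chord (1/10) (3/10) + 9 * eps) by (apply Rmax_lub; lra).
    lra.
Qed.

(** The linear part of [T] minus the identity is small on the three independent chords of
    [det3_chords], hence small. The constant depends on neither [T] nor [eps]. *)
Lemma near_crease_near_identity : exists K, 0 <= K /\
  forall T eps, isometry3 T -> eps < 1/20000 -> near_crease T eps ->
  forall p u, vnorm (vsub (vsub (T (vadd p u)) (T p)) u) <= K * eps * vnorm u.
Proof.
  destruct (det3_control _ _ _ det3_chords) as (K & HK & Hctl).
  exists (3 * (K * 62)); split; [lra|].
  intros T eps HT He Hn p u.
  pose proof (near_crease_fixes_points T eps HT He Hn) as Hfix.
  destruct (isometry3_affine T HT) as (f1 & f2 & f3 & HL).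
  assert (Hc : forall s t, I0 s -> I0 t ->
    vnorm (vsub (vsub (T (c0 t)) (T (c0 s))) (vsub (c0 t) (c0 s))) <= 62 * eps).
  { intros s t Is It.
    replace (vsub (vsub (T (c0 t)) (T (c0 s))) (vsub (c0 t) (c0 s)))
      with (vadd (vsub (T (c0 t)) (c0 t)) (vsub (c0 s) (T (c0 s)))) by v3ring.
    eapply Rle_trans; [apply vnorm_add_le|].
    rewrite (vnorm_subC (c0 s)); pose proof (Hfix _ Is); pose proof (Hfix _ It); lra. }
  (* The rows of the linear part minus the identity. Each is controlled by its products with the
     chords, which are at most [62 * eps] because both ends of a chord move by at most
     [31 * eps]. *)
  set (M1 := (vx f1 - 1, vx f2, vx f3) : V3).
  set (M2 := (vy f1, vy f2 - 1, vy f3) : V3).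
  set (M3 := (vz f1, vz f2, vz f3 - 1) : V3).
  assert (HM : forall p u, vsub (vsub (T (vadd p u)) (T p)) u = (vdot M1 u, vdot M2 u, vdot M3 u)).
  { intros q w; rewrite HL; unfold M1, M2, M3; v3ring. }
  assert (Hrow : forall s t, I0 s -> I0 t ->
    Rabs (vdot M1 (vsub (c0 t) (c0 s))) <= 62 * eps /\
    Rabs (vdot M2 (vsub (c0 t) (c0 s))) <= 62 * eps /\
    Rabs (vdot M3 (vsub (c0 t) (c0 s))) <= 62 * eps).
  { intros s t Is It.
    pose proof (Hc s t Is It) as Hst.
    replace (c0 t) with (vadd (c0 s) (vsub (c0 t) (c0 s))) in Hst at 1 by v3ring.
    rewrite HM in Hst; set (w := vsub (c0 t) (c0 s)) in *.
    set (z := (vdot M1 w, vdot M2 w, vdot M3 w) : V3) in *.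
    assert (Hz : forall a, vnorm a = 1 -> Rabs (vdot a z) <= 62 * eps).
    { intros a Ha; eapply Rle_trans; [apply Rabs_vdot_le|]; rewrite Ha; lra. }
    split; [|split].
    - replace (vdot M1 w) with (vdot (1, 0, 0) z) by (unfold z, vdot; cbn; ring).
      apply Hz, vnorm_unit; v3ring.
    - replace (vdot M2 w) with (vdot (0, 1, 0) z) by (unfold z, vdot; cbn; ring).
      apply Hz, vnorm_unit; v3ring.
    - replace (vdot M3 w) with (vdot (0, 0, 1) z) by (unfold z, vdot; cbn; ring).
      apply Hz, vnorm_unit; v3ring. }
  destruct (Hrow (1/10) (3/10)) as (? & ? & ?); [unfold I0; lra..|].
  destruct (Hrow (3/10) (5/10)) as (? & ? & ?); [unfold I0; lra..|].
  destruct (Hrow (5/10) (7/10)) as (? & ? & ?); [unfold I0; lra..|].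
  assert (N1 : vnorm M1 <= K * (62 * eps)) by auto.
  assert (N2 : vnorm M2 <= K * (62 * eps)) by auto.
  assert (N3 : vnorm M3 <= K * (62 * eps)) by auto.
  rewrite HM; eapply Rle_trans; [apply vnorm_le_coord|]; cbn [vx vy vz fst snd].
  pose proof (Rabs_vdot_le M1 u); pose proof (Rabs_vdot_le M2 u); pose proof (Rabs_vdot_le M3 u).
  pose proof (vnorm_ge0 u); nra.
Qed.

(** * Local Lipschitz functions *)

(** This is the regularity used in place of smoothness: it is stable under the operations that build
    rulings, and for a derivative it yields first-order expansions with an explicit error. *)
Definition loc_lip (f : R -> R) (x : R) : Prop :=
  exists K r, 0 <= K /\ 0 < r /\
  forall s t, Rabs (s - x) < r -> Rabs (t - x) < r -> Rabs (f s - f t) <= K * Rabs (s - t).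

Lemma loc_lip_ext_near f g x r : 0 < r -> (forall t, Rabs (t - x) < r -> f t = g t) ->
  loc_lip g x -> loc_lip f x.
Proof.
  intros Hr Hfg (K & r' & HK & Hr' & H).
  exists K, (Rmin r r'); split; [exact HK|split; [now apply Rmin_glb_lt|]].
  intros s t Hs Ht; apply Rmin_Rgt in Hs; apply Rmin_Rgt in Ht.
  rewrite !Hfg by tauto; apply H; tauto.
Qed.

Lemma loc_lip_ext f g x : (forall t, f t = g t) -> loc_lip g x -> loc_lip f x.
Proof. intros H; apply (loc_lip_ext_near f g x 1); auto; lra. Qed.

Lemma loc_lip_bounded_deriv f f' x r M : 0 < r -> 0 <= M ->
  (forall t, Rabs (t - x) < r -> derivable_pt_lim f t (f' t) /\ Rabs (f' t) <= M) -> loc_lip f x.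
Proof.
  intros Hr HM H; exists M, r; repeat split; auto; intros s t Hs Ht.
  apply Rabs_def2 in Hs; apply Rabs_def2 in Ht.
  assert (Hin : forall u, Rmin t s <= u <= Rmax t s -> Rabs (u - x) < r).
  { intros u Hu; apply Rabs_def1; revert Hu; unfold Rmin, Rmax; destruct (Rle_dec t s); lra. }
  destruct (MVT_gen f t s f') as (c & Hc & Hd).
  - intros u Hu; apply is_derive_Reals, H, Hin; lra.
  - intros u Hu; apply derivable_continuous_pt; exists (f' u); apply H, Hin, Hu.
  - rewrite Hd, Rabs_mult; apply Rmult_le_compat_r; [apply Rabs_pos|apply H, Hin, Hc].
Qed.

Lemma loc_lip_bounded f x : loc_lip f x ->
  exists M r, 0 <= M /\ 0 < r /\ forall t, Rabs (t - x) < r -> Rabs (f t) <= M.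
Proof.
  intros (K & r & HK & Hr & H).
  pose proof (Rabs_pos (f x)).
  exists (Rabs (f x) + K * r), r; repeat split; auto; [nra|].
  intros t Ht.
  assert (Hx : Rabs (x - x) < r) by (rewrite Rminus_diag, Rabs_R0; exact Hr).
  specialize (H t x Ht Hx).
  replace (f t) with ((f t - f x) + f x) by ring.
  eapply Rle_trans; [apply Rabs_triang|].
  assert (K * Rabs (t - x) <= K * r) by (apply Rmult_le_compat_l; lra); lra.
Qed.

Lemma loc_lip_of_deriv f f' x r : 0 < r ->
  (forall t, Rabs (t - x) < r -> derivable_pt_lim f t (f' t)) -> loc_lip f' x -> loc_lip f x.
Proof.
  intros Hr Hd Hf'; destruct (loc_lip_bounded _ _ Hf') as (M & r' & HM & Hr' & Hb).
  apply (loc_lip_bounded_deriv f f' x (Rmin r r') M); auto; [now apply Rmin_glb_lt|].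
  intros t Ht; apply Rmin_Rgt in Ht; split; [apply Hd|apply Hb]; tauto.
Qed.

Lemma loc_lip_const c x : loc_lip (fun _ => c) x.
Proof.
  exists 0, 1; repeat split; try lra; intros; rewrite Rminus_diag, Rabs_R0; lra.
Qed.

Lemma loc_lip_id x : loc_lip (fun t => t) x.
Proof. exists 1, 1; repeat split; try lra; intros; lra. Qed.

Lemma loc_lip_plus f g x : loc_lip f x -> loc_lip g x -> loc_lip (fun t => f t + g t) x.
Proof.
  intros (K & r & HK & Hr & H) (K' & r' & HK' & Hr' & H').
  exists (K + K'), (Rmin r r'); split; [lra|split; [now apply Rmin_glb_lt|]].
  intros s t Hs Ht; apply Rmin_Rgt in Hs; apply Rmin_Rgt in Ht.
  replace (f s + g s - (f t + g t)) with ((f s - f t) + (g s - g t)) by ring.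
  eapply Rle_trans; [apply Rabs_triang|].
  specialize (H s t ltac:(tauto) ltac:(tauto)); specialize (H' s t ltac:(tauto) ltac:(tauto)); lra.
Qed.

Lemma loc_lip_mult f g x : loc_lip f x -> loc_lip g x -> loc_lip (fun t => f t * g t) x.
Proof.
  intros Hf Hg.
  destruct (loc_lip_bounded _ _ Hf) as (M & r1 & HM & Hr1 & B1).
  destruct (loc_lip_bounded _ _ Hg) as (M' & r2 & HM' & Hr2 & B2).
  destruct Hf as (K & r & HK & Hr & H); destruct Hg as (K' & r' & HK' & Hr' & H').
  exists (K * M' + M * K'), (Rmin (Rmin r r') (Rmin r1 r2)); split; [nra|split; [repeat apply Rmin_glb_lt; auto|]].
  intros s t Hs Ht.
  apply Rmin_Rgt in Hs; destruct Hs as [Hs Hs']; apply Rmin_Rgt in Hs; apply Rmin_Rgt in Hs'.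
  apply Rmin_Rgt in Ht; destruct Ht as [Ht Ht']; apply Rmin_Rgt in Ht; apply Rmin_Rgt in Ht'.
  specialize (H s t ltac:(tauto) ltac:(tauto)); specialize (H' s t ltac:(tauto) ltac:(tauto)).
  specialize (B1 t ltac:(tauto)); specialize (B2 s ltac:(tauto)).
  replace (f s * g s - f t * g t) with ((f s - f t) * g s + f t * (g s - g t)) by ring.
  eapply Rle_trans; [apply Rabs_triang|]; rewrite !Rabs_mult.
  pose proof (Rabs_pos (g s)); pose proof (Rabs_pos (f t)); pose proof (Rabs_pos (f s - f t));
  pose proof (Rabs_pos (g s - g t)); pose proof (Rabs_pos (s - t)).
  assert (Rabs (f s - f t) * Rabs (g s) <= (K * Rabs (s - t)) * M') by (apply Rmult_le_compat; auto).
  assert (Rabs (f t) * Rabs (g s - g t) <= M * (K' * Rabs (s - t))) by (apply Rmult_le_compat; auto).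
  lra.
Qed.

Lemma loc_lip_opp f x : loc_lip f x -> loc_lip (fun t => - f t) x.
Proof.
  intros Hf; apply loc_lip_ext with (fun t => -1 * f t); [intros; ring|].
  apply loc_lip_mult; [apply loc_lip_const|exact Hf].
Qed.

Lemma loc_lip_minus f g x : loc_lip f x -> loc_lip g x -> loc_lip (fun t => f t - g t) x.
Proof. intros Hf Hg; apply loc_lip_plus; [exact Hf|now apply loc_lip_opp]. Qed.

Lemma loc_lip_pow f n x : loc_lip f x -> loc_lip (fun t => f t ^ n) x.
Proof.
  intros Hf; induction n as [|n IH]; [apply (loc_lip_const 1)|].
  now apply (loc_lip_mult f (fun t => f t ^ n)).
Qed.

Lemma loc_lip_comp g f x : loc_lip f x -> loc_lip g (f x) -> loc_lip (fun t => g (f t)) x.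
Proof.
  intros (K & r & HK & Hr & H) (K' & r' & HK' & Hr' & H').
  assert (Hq : 0 < r' / (K + 1)) by (apply Rdiv_lt_0_compat; lra).
  assert (Hin : forall t, Rabs (t - x) < Rmin r (r' / (K + 1)) -> Rabs (f t - f x) < r').
  { intros t Ht; apply Rmin_Rgt in Ht.
    assert (Hx : Rabs (x - x) < r) by (rewrite Rminus_diag, Rabs_R0; exact Hr).
    specialize (H t x ltac:(tauto) Hx).
    assert ((K + 1) * Rabs (t - x) < (K + 1) * (r' / (K + 1))) by (apply Rmult_lt_compat_l; [lra|tauto]).
    replace ((K + 1) * (r' / (K + 1))) with r' in * by (field; lra).
    pose proof (Rabs_pos (t - x)); lra. }
  exists (K' * K), (Rmin r (r' / (K + 1))); split; [nra|split; [now apply Rmin_glb_lt|]].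
  intros s t Hs Ht; eapply Rle_trans; [apply H'; now apply Hin|].
  rewrite Rmult_assoc; apply Rmult_le_compat_l; [exact HK'|].
  apply Rmin_Rgt in Hs; apply Rmin_Rgt in Ht; apply H; tauto.
Qed.

Lemma loc_lip_inv_at y : y <> 0 -> loc_lip Rinv y.
Proof.
  intros Hy; assert (Hp : 0 < Rabs y) by now apply Rabs_pos_lt.
  exists (/ (Rabs y / 2 * (Rabs y / 2))), (Rabs y / 2).
  split; [apply Rlt_le, Rinv_0_lt_compat; nra|split; [lra|]].
  assert (Hlow : forall s, Rabs (s - y) < Rabs y / 2 -> Rabs y / 2 < Rabs s).
  { intros s Hs; pose proof (Rabs_triang (y - s) s) as H; replace (y - s + s) with y in H by ring.
    rewrite Rabs_minus_sym in H; lra. }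
  intros s t Hs Ht; apply Hlow in Hs; apply Hlow in Ht.
  assert (s <> 0) by (intros ->; rewrite Rabs_R0 in Hs; lra).
  assert (t <> 0) by (intros ->; rewrite Rabs_R0 in Ht; lra).
  replace (/ s - / t) with (/ (s * t) * (t - s)) by (field; auto).
  rewrite Rabs_mult, (Rabs_minus_sym t s), Rabs_inv, Rabs_mult.
  apply Rmult_le_compat_r; [apply Rabs_pos|].
  apply Rinv_le_contravar; nra.
Qed.

Lemma loc_lip_div f g x : g x <> 0 -> loc_lip f x -> loc_lip g x -> loc_lip (fun t => f t / g t) x.
Proof.
  intros Hg Hf HG; apply loc_lip_mult; [exact Hf|].
  apply (loc_lip_comp Rinv g); [exact HG|now apply loc_lip_inv_at].
Qed.

Lemma loc_lip_inv g x : g x <> 0 -> loc_lip g x -> loc_lip (fun t => / g t) x.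
Proof. intros Hg HG; apply (loc_lip_comp Rinv g); [exact HG|now apply loc_lip_inv_at]. Qed.

Lemma loc_lip_sin f x : loc_lip f x -> loc_lip (fun t => sin (f t)) x.
Proof.
  intros Hf; apply (loc_lip_comp sin f); [exact Hf|].
  apply (loc_lip_bounded_deriv sin cos _ 1 1); try lra.
  intros t _; split; [apply derivable_pt_lim_sin|apply Rabs_le, COS_bound].
Qed.

Lemma loc_lip_cos f x : loc_lip f x -> loc_lip (fun t => cos (f t)) x.
Proof.
  intros Hf; apply (loc_lip_comp cos f); [exact Hf|].
  apply (loc_lip_bounded_deriv cos (fun t => - sin t) _ 1 1); try lra.
  intros t _; split; [apply derivable_pt_lim_cos|rewrite Rabs_Ropp; apply Rabs_le, SIN_bound].
Qed.

Lemma loc_lip_atan f x : loc_lip f x -> loc_lip (fun t => atan (f t)) x.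
Proof.
  intros Hf; apply (loc_lip_comp atan f); [exact Hf|].
  apply (loc_lip_bounded_deriv atan (fun t => / (1 + t ^ 2)) _ 1 1); try lra.
  intros t _; split; [apply is_derive_Reals; auto_derive; auto; field; nra|].
  rewrite Rabs_pos_eq by (apply Rlt_le, Rinv_0_lt_compat, one_plus_sqr_gt0).
  rewrite <- Rinv_1; apply Rinv_le_contravar; nra.
Qed.

Lemma loc_lip_sqrt f x : 0 < f x -> loc_lip f x -> loc_lip (fun t => sqrt (f t)) x.
Proof.
  intros Hp Hf; apply (loc_lip_comp sqrt f); [exact Hf|]; set (y := f x) in *.
  assert (0 < sqrt (y / 2)) by (apply sqrt_lt_R0; lra).
  apply (loc_lip_bounded_deriv sqrt (fun t => / (2 * sqrt t)) y (y / 2) (/ (2 * sqrt (y / 2)))).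
  - lra.
  - apply Rlt_le, Rinv_0_lt_compat; lra.
  - intros t Ht; apply Rabs_def2 in Ht.
    assert (sqrt (y / 2) <= sqrt t) by (apply sqrt_le_1; lra).
    split; [apply derivable_pt_lim_sqrt; lra|].
    rewrite Rabs_pos_eq by (apply Rlt_le, Rinv_0_lt_compat; lra).
    apply Rinv_le_contravar; lra.
Qed.

Ltac loc_lip_auto :=
  repeat first
    [ apply loc_lip_const | apply loc_lip_id | assumption
    | apply loc_lip_sin | apply loc_lip_cos | apply loc_lip_atan
    | apply loc_lip_plus | apply loc_lip_minus | apply loc_lip_opp
    | apply loc_lip_div | apply loc_lip_inv | apply loc_lip_mult | apply loc_lip_pow ].

(** * Vector-valued maps and strict differentiability *)

Definition loc_lipv (X : R -> V3) (x : R) : Prop :=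
  loc_lip (fun t => vx (X t)) x /\ loc_lip (fun t => vy (X t)) x /\ loc_lip (fun t => vz (X t)) x.

Lemma loc_lipv_norm X x : loc_lipv X x -> exists K r, 0 <= K /\ 0 < r /\
  forall s t, Rabs (s - x) < r -> Rabs (t - x) < r -> vnorm (vsub (X s) (X t)) <= K * Rabs (s - t).
Proof.
  intros ((K1 & r1 & HK1 & Hr1 & H1) & (K2 & r2 & HK2 & Hr2 & H2) & (K3 & r3 & HK3 & Hr3 & H3)).
  exists (K1 + K2 + K3), (Rmin r1 (Rmin r2 r3)); split; [lra|split; [repeat apply Rmin_glb_lt; auto|]].
  intros s t Hs Ht.
  apply Rmin_Rgt in Hs; destruct Hs as [Hs Hs']; apply Rmin_Rgt in Hs'.
  apply Rmin_Rgt in Ht; destruct Ht as [Ht Ht']; apply Rmin_Rgt in Ht'.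
  specialize (H1 s t Hs Ht); specialize (H2 s t ltac:(tauto) ltac:(tauto));
  specialize (H3 s t ltac:(tauto) ltac:(tauto)).
  eapply Rle_trans; [apply vnorm_le_coord|].
  cbn [vsub vx vy vz fst snd]; unfold vx, vy, vz in *; lra.
Qed.

(** Strict differentiability at [x] with a rate. Both points may vary near [x], as is needed for
    secants that start at the image of the base point rather than at the base point itself. *)
Lemma loc_lip_strict_diff f f' x : (forall t, derivable_pt_lim f t (f' t)) -> loc_lip f' x ->
  exists K r, 0 <= K /\ 0 < r /\ forall rho s t, rho < r -> Rabs (s - x) <= rho -> Rabs (t - x) <= rho ->
    Rabs (f t - f s - (t - s) * f' x) <= K * rho * Rabs (t - s).
Proof.
  intros Hd (K & r & HK & Hr & H); exists K, r; repeat split; auto.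
  intros rho s t Hrho Hs Ht.
  apply Rabs_le_between in Hs; apply Rabs_le_between in Ht.
  destruct (MVT_gen f s t f') as (c & Hc & Hm).
  - intros u _; apply is_derive_Reals, Hd.
  - intros u _; apply derivable_continuous_pt; exists (f' u); apply Hd.
  - assert (Hcx : Rabs (c - x) <= rho)
      by (apply Rabs_le; revert Hc; unfold Rmin, Rmax; destruct (Rle_dec s t); lra).
    rewrite Hm; replace (f' c * (t - s) - (t - s) * f' x) with ((f' c - f' x) * (t - s)) by ring.
    rewrite Rabs_mult; apply Rmult_le_compat_r; [apply Rabs_pos|].
    assert (Hx : Rabs (x - x) < r) by (rewrite Rminus_diag, Rabs_R0; exact Hr).
    eapply Rle_trans; [apply H; [lra|exact Hx]|apply Rmult_le_compat_l; auto].
Qed.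

Lemma loc_lipv_strict_diff c E x : (forall t, vderiv c t (E t)) -> loc_lipv E x ->
  exists K r, 0 <= K /\ 0 < r /\ forall rho s t, rho < r -> Rabs (s - x) <= rho -> Rabs (t - x) <= rho ->
    vnorm (vsub (vsub (c t) (c s)) (vscale (t - s) (E x))) <= K * rho * Rabs (t - s).
Proof.
  intros Hd (L1 & L2 & L3).
  destruct (loc_lip_strict_diff (fun t => vx (c t)) _ x (fun t => proj1 (Hd t)) L1) as (K1 & r1 & HK1 & Hr1 & H1).
  destruct (loc_lip_strict_diff (fun t => vy (c t)) _ x (fun t => proj1 (proj2 (Hd t))) L2) as (K2 & r2 & HK2 & Hr2 & H2).
  destruct (loc_lip_strict_diff (fun t => vz (c t)) _ x (fun t => proj2 (proj2 (Hd t))) L3) as (K3 & r3 & HK3 & Hr3 & H3).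
  exists (K1 + K2 + K3), (Rmin r1 (Rmin r2 r3)); split; [lra|split; [repeat apply Rmin_glb_lt; auto|]].
  intros rho s t Hrho Hs Ht.
  apply Rmin_Rgt in Hrho; destruct Hrho as [Hr Hr']; apply Rmin_Rgt in Hr'.
  specialize (H1 rho s t Hr Hs Ht); specialize (H2 rho s t ltac:(tauto) Hs Ht);
  specialize (H3 rho s t ltac:(tauto) Hs Ht).
  eapply Rle_trans; [apply vnorm_le_coord|].
  cbn [vsub vscale vx vy vz fst snd]; unfold vx, vy, vz in *; lra.
Qed.

(** * Secants of a folded strip *)

(** The error is relative to the size of the coefficients, not to the length of the secant. The sign
    conditions in [plus_secant] and [minus_secant] are what later exclude cancellation between the
    two. *)
Definition model_err (y y' E Xp Xm : V3) (d p m h : R) : Prop :=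
  vnorm (vsub (vsub y' y) (vadd (vscale d E) (vadd (vscale p Xp) (vscale m Xm))))
  <= h * (Rabs d + Rabs p + Rabs m).

(* Secants leaving a point of the sheet v >= 0, respectively v < 0, with their linear models. *)
Definition plus_secant (y y' E Xp Xm : V3) (h : R) : Prop :=
  exists d p m, (m = 0 \/ (p <= 0 /\ m <= 0)) /\ model_err y y' E Xp Xm d p m h.
Definition minus_secant (y y' E Xp Xm : V3) (h : R) : Prop :=
  exists d p m, (p = 0 \/ (0 <= p /\ 0 <= m)) /\ model_err y y' E Xp Xm d p m h.

Lemma vnorm_add3_le p q r : vnorm (vadd p (vadd q r)) <= vnorm p + vnorm q + vnorm r.
Proof. pose proof (vnorm_add_le p (vadd q r)); pose proof (vnorm_add_le q r); lra. Qed.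

Lemma secant_model (s : R -> V3) a E x :
  (forall t, vderiv s t (E t)) -> loc_lipv E x ->
  loc_lipv (ruling s a) x -> loc_lipv (ruling s (fun u => - a u)) x ->
  exists K r, 0 <= K /\ 0 < r /\ forall rho t v, rho < r ->
    Rabs (t - x) <= rho -> Rabs v <= rho ->
    (forall t' v', Rabs (t' - x) <= rho -> Rabs v' <= rho ->
      plus_secant (phi_map s a t v) (phi_map s a t' v') (E x)
        (ruling s a x) (ruling s (fun u => - a u) x) (K * rho)) \/
    (forall t' v', Rabs (t' - x) <= rho -> Rabs v' <= rho ->
      minus_secant (phi_map s a t v) (phi_map s a t' v') (E x)
        (ruling s a x) (ruling s (fun u => - a u) x) (K * rho)).
Proof.
  intros Hd HE HX HY.
  set (X := ruling s a) in *; set (Y := ruling s (fun u => - a u)) in *.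
  destruct (loc_lipv_strict_diff s E x Hd HE) as (K1 & r1 & HK1 & Hr1 & H1).
  destruct (loc_lipv_norm X x HX) as (K2 & r2 & HK2 & Hr2 & H2).
  destruct (loc_lipv_norm Y x HY) as (K3 & r3 & HK3 & Hr3 & H3).
  set (K := K1 + K2 + K3).
  exists K, (Rmin r1 (Rmin r2 r3)); split; [unfold K; lra|split; [repeat apply Rmin_glb_lt; auto|]].
  intros rho t v Hrho Ht Hv.
  apply Rmin_Rgt in Hrho; destruct Hrho as [Hr Hr']; apply Rmin_Rgt in Hr'; destruct Hr' as [Hr' Hr''].
  assert (Hrho0 : 0 <= rho) by (pose proof (Rabs_pos v); lra).
  assert (Hx : Rabs (x - x) <= rho) by (rewrite Rminus_diag, Rabs_R0; exact Hrho0).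
  (* Both points lie on one sheet with ruling field [Z]. The error splits into that of the crease,
     the change of [Z] from [x] to [t'] with weight [v' - v], and the change from [t] to [t'] with
     weight [v]. *)
  assert (Hsame : forall Z L, 0 <= L <= K2 + K3 ->
    (forall u w, Rabs (u - x) <= rho -> Rabs (w - x) <= rho -> vnorm (vsub (Z u) (Z w)) <= L * Rabs (u - w)) ->
    forall t' v', Rabs (t' - x) <= rho -> Rabs v' <= rho ->
    vnorm (vsub (vsub (vadd (s t') (vscale v' (Z t'))) (vadd (s t) (vscale v (Z t))))
      (vadd (vscale (t' - t) (E x)) (vscale (v' - v) (Z x))))
    <= K * rho * (Rabs (t' - t) + Rabs (v' - v))).
  { intros Z L HL HZ t' v' Ht' Hv'.
    replace (vsub _ _) with
      (vadd (vsub (vsub (s t') (s t)) (vscale (t' - t) (E x)))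
        (vadd (vscale (v' - v) (vsub (Z t') (Z x))) (vscale v (vsub (Z t') (Z t))))) by v3ring.
    eapply Rle_trans; [apply vnorm_add3_le|]; rewrite !vnorm_scale.
    specialize (H1 rho t t' Hr Ht Ht').
    pose proof (HZ t' x Ht' Hx); pose proof (HZ t' t Ht' Ht).
    pose proof (Rabs_pos (t' - t)); pose proof (Rabs_pos (v' - v)); pose proof (Rabs_pos v).
    assert (Rabs (v' - v) * vnorm (vsub (Z t') (Z x)) <= Rabs (v' - v) * (L * rho)).
    { apply Rmult_le_compat_l; [auto|]. eapply Rle_trans; [eassumption|]. apply Rmult_le_compat_l; lra. }
    assert (Rabs v * vnorm (vsub (Z t') (Z t)) <= rho * (L * Rabs (t' - t)))
      by (apply Rmult_le_compat; auto; apply vnorm_ge0).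
    assert (0 <= rho * Rabs (t' - t)) by nra; assert (0 <= rho * Rabs (v' - v)) by nra.
    unfold K; nra. }
  (* The points lie on different sheets. The secant goes back along the ruling of [Z] to the crease,
     along the crease, and out along the ruling of [W], so the coefficients are [- v] and [v']. *)
  assert (Hcross : forall Z W L M, 0 <= L <= K2 + K3 -> 0 <= M <= K2 + K3 ->
    (forall u w, Rabs (u - x) <= rho -> Rabs (w - x) <= rho -> vnorm (vsub (Z u) (Z w)) <= L * Rabs (u - w)) ->
    (forall u w, Rabs (u - x) <= rho -> Rabs (w - x) <= rho -> vnorm (vsub (W u) (W w)) <= M * Rabs (u - w)) ->
    forall t' v', Rabs (t' - x) <= rho -> Rabs v' <= rho ->
    vnorm (vsub (vsub (vadd (s t') (vscale v' (W t'))) (vadd (s t) (vscale v (Z t))))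
      (vadd (vscale (t' - t) (E x)) (vadd (vscale (- v) (Z x)) (vscale v' (W x)))))
    <= K * rho * (Rabs (t' - t) + Rabs (- v) + Rabs v')).
  { intros Z W L M HL HM HZ HW t' v' Ht' Hv'.
    replace (vsub _ _) with
      (vadd (vsub (vsub (s t') (s t)) (vscale (t' - t) (E x)))
        (vadd (vscale v' (vsub (W t') (W x))) (vscale (- v) (vsub (Z t) (Z x))))) by v3ring.
    eapply Rle_trans; [apply vnorm_add3_le|]; rewrite !vnorm_scale.
    specialize (H1 rho t t' Hr Ht Ht').
    pose proof (HZ t x Ht Hx); pose proof (HW t' x Ht' Hx).
    pose proof (Rabs_pos (t' - t)); pose proof (Rabs_pos (- v)); pose proof (Rabs_pos v').
    assert (Rabs v' * vnorm (vsub (W t') (W x)) <= Rabs v' * (M * rho)).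
    { apply Rmult_le_compat_l; [auto|]. eapply Rle_trans; [eassumption|]. apply Rmult_le_compat_l; lra. }
    assert (Rabs (- v) * vnorm (vsub (Z t) (Z x)) <= Rabs (- v) * (L * rho)).
    { apply Rmult_le_compat_l; [auto|]. eapply Rle_trans; [eassumption|]. apply Rmult_le_compat_l; lra. }
    assert (0 <= rho * Rabs (t' - t)) by nra; assert (0 <= rho * Rabs (- v)) by nra;
    assert (0 <= rho * Rabs v') by nra.
    unfold K; nra. }
  assert (HXl : forall u w, Rabs (u - x) <= rho -> Rabs (w - x) <= rho -> vnorm (vsub (X u) (X w)) <= K2 * Rabs (u - w))
    by (intros; apply H2; lra).
  assert (HYl : forall u w, Rabs (u - x) <= rho -> Rabs (w - x) <= rho -> vnorm (vsub (Y u) (Y w)) <= K3 * Rabs (u - w))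
    by (intros; apply H3; lra).
  assert (Hphi : forall u w, phi_map s a u w = if Rle_dec 0 w then vadd (s u) (vscale w (X u)) else vadd (s u) (vscale w (Y u)))
    by reflexivity.
  rewrite !Hphi; destruct (Rle_dec 0 v) as [Hv0|Hv0]; [left|right]; intros t' v' Ht' Hv'; rewrite Hphi;
    destruct (Rle_dec 0 v') as [Hv0'|Hv0'].
  - exists (t' - t), (v' - v), 0; split; [now left|]; unfold model_err.
    replace (vadd (vscale (v' - v) (X x)) (vscale 0 (Y x))) with (vscale (v' - v) (X x)) by v3ring.
    rewrite Rabs_R0, Rplus_0_r; apply Hsame with K2; auto; lra.
  - exists (t' - t), (- v), v'; split; [right; lra|]; unfold model_err.
    apply Hcross with K2 K3; auto; lra.
  - exists (t' - t), v', (- v); split; [right; lra|]; unfold model_err.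
    replace (vadd (vscale v' (X x)) (vscale (- v) (Y x))) with (vadd (vscale (- v) (Y x)) (vscale v' (X x))) by v3ring.
    rewrite Rplus_assoc, (Rplus_comm (Rabs v')), <- Rplus_assoc.
    apply Hcross with K3 K2; auto; lra.
  - exists (t' - t), 0, (v' - v); split; [now left|]; unfold model_err.
    replace (vadd (vscale 0 (X x)) (vscale (v' - v) (Y x))) with (vscale (v' - v) (Y x)) by v3ring.
    rewrite Rabs_R0, Rplus_0_r; apply Hsame with K3; auto; lra.
Qed.

(* [N], [B], [F] are the components of a secant along the normal, the binormal and the tangent;
   the first three bounds express it through a folding of angle (C, S), the last three through
   the ruling of angle (C', S') of length v. *)
Lemma secant_angle_rigidity C S sp sm kp km sg th z C' S' s v N B F d p m :
  0 < C <= 1 -> 0 < sp <= 1 -> 0 < sm <= 1 -> Rabs S <= 1 -> Rabs kp <= 1 -> Rabs km <= 1 -> Rabs sg = 1 ->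
  0 < v -> 0 <= th -> 0 <= z ->
  m = 0 \/ (p <= 0 /\ m <= 0) ->
  Rabs (N - (p * sp + m * sm) * C) <= th * (Rabs d + Rabs p + Rabs m) ->
  Rabs (B - (p * sp - m * sm) * S) <= th * (Rabs d + Rabs p + Rabs m) ->
  Rabs (F - (d * sg + p * kp + m * km)) <= th * (Rabs d + Rabs p + Rabs m) ->
  Rabs (N - v * (s * C')) <= z * v -> Rabs (B - v * (s * S')) <= z * v -> Rabs F <= v -> Rabs N <= v ->
  let h := Rmin sp sm * C in
  let w := z + 6 * th / h in
  6 * th <= h -> w < s * C' -> 2 * w < s * Rabs (S * C' - C * S') -> False.
Proof.
  intros HC Hsp Hsm HS Hkp Hkm Hsg Hv Hth Hz Hpm HN HB HF HN' HB' HFv HNv h w Hth6 Hw1 Hw2.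
  assert (Hmin : 0 < Rmin sp sm) by (apply Rmin_glb_lt; lra).
  pose proof (Rmin_l sp sm); pose proof (Rmin_r sp sm).
  assert (Hh : 0 < h <= 1) by (unfold h; split; [apply Rmult_lt_0_compat|]; nra).
  set (D := Rabs d + Rabs p + Rabs m) in *.
  pose proof (Rabs_pos d); pose proof (Rabs_pos p); pose proof (Rabs_pos m).
  (* There is no cancellation: either [m] vanishes or [p] and [m] have the same sign, so the normal
     component of the model controls both. *)
  assert (Hpmh : h * (Rabs p + Rabs m) <= Rabs ((p * sp + m * sm) * C)).
  { rewrite Rabs_mult, (Rabs_pos_eq C) by lra; unfold h.
    assert (Rmin sp sm * (Rabs p + Rabs m) <= Rabs (p * sp + m * sm)); [|nra].
    destruct Hpm as [->|[Hp Hm]].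
    - rewrite Rabs_R0, Rmult_0_l, !Rplus_0_r, Rabs_mult, (Rabs_pos_eq sp) by lra; nra.
    - rewrite (Rabs_left1 p), (Rabs_left1 m), (Rabs_left1 (p * sp + m * sm)) by nra; nra. }
  assert (Hpmb : h * (Rabs p + Rabs m) <= v + th * D).
  { pose proof (Rabs_triang (- (N - (p * sp + m * sm) * C)) N) as Ht.
    rewrite Rabs_Ropp in Ht.
    replace (- (N - (p * sp + m * sm) * C) + N) with ((p * sp + m * sm) * C) in Ht by ring; lra. }
  assert (Hdb : Rabs d <= v + (Rabs p + Rabs m) + th * D).
  { assert (Rabs d = Rabs (d * sg)) as -> by (rewrite Rabs_mult, Hsg; ring).
    replace (d * sg) with (F + - (F - (d * sg + p * kp + m * km)) + (- (p * kp) + - (m * km))) by ring.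
    pose proof (Rabs_triang (F + - (F - (d * sg + p * kp + m * km))) (- (p * kp) + - (m * km))).
    pose proof (Rabs_triang F (- (F - (d * sg + p * kp + m * km)))).
    pose proof (Rabs_triang (- (p * kp)) (- (m * km))).
    rewrite !Rabs_Ropp, !Rabs_mult in *; nra. }
  (* Adding the bounds for [d], [p] and [m] gives [h * D <= 3 * v + 3 * (th * D)], and [6 * th <= h]
     absorbs the last term into half of the left side. *)
  assert (HD : h * D <= 6 * v).
  { assert (h * Rabs d <= h * (v + (Rabs p + Rabs m) + th * D)) by (apply Rmult_le_compat_l; lra).
    assert (0 <= D) by (unfold D; lra).
    assert (0 <= th * D) by nra.
    assert (h * D = h * Rabs d + h * (Rabs p + Rabs m)) by (unfold D; ring).
    assert (6 * (th * D) <= h * D) by (rewrite <- Rmult_assoc; apply Rmult_le_compat_r; lra).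
    nra. }
  assert (Herr : th * D <= 6 * th / h * v).
  { replace (th * D) with (th / h * (h * D)) by (field; lra).
    replace (6 * th / h * v) with (th / h * (6 * v)) by (field; lra).
    apply Rmult_le_compat_l; [apply Rle_mult_inv_pos; lra|exact HD]. }
  assert (Hw : z * v + th * D <= w * v) by (unfold w; nra).
  assert (E1 : Rabs (v * (s * C') - (p * sp + m * sm) * C) <= w * v).
  { pose proof (Rabs_triang (- (N - v * (s * C'))) (N - (p * sp + m * sm) * C)) as Ht.
    rewrite Rabs_Ropp in Ht.
    replace (- (N - v * (s * C')) + (N - (p * sp + m * sm) * C)) with (v * (s * C') - (p * sp + m * sm) * C) in Ht by ring; lra. }
  assert (E2 : Rabs (v * (s * S') - (p * sp - m * sm) * S) <= w * v).
  { pose proof (Rabs_triang (- (B - v * (s * S'))) (B - (p * sp - m * sm) * S)) as Ht.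
    rewrite Rabs_Ropp in Ht.
    replace (- (B - v * (s * S')) + (B - (p * sp - m * sm) * S)) with (v * (s * S') - (p * sp - m * sm) * S) in Ht by ring; lra. }
  (* If [m = 0], eliminating [p] between [E1] and [E2] leaves the determinant [S * C' - C * S'], too
     large for the error. Otherwise the model points to the negative normal side, while the ruling
     points to the positive one by more than the error. *)
  destruct Hpm as [->|[Hp Hm]].
  - pose proof (Rabs_triang (S * (v * (s * C') - (p * sp + 0 * sm) * C)) (- (C * (v * (s * S') - (p * sp - 0 * sm) * S)))) as Ht.
    rewrite Rabs_Ropp, !Rabs_mult, (Rabs_pos_eq C) in Ht by lra.
    replace (S * (v * (s * C') - (p * sp + 0 * sm) * C) + - (C * (v * (s * S') - (p * sp - 0 * sm) * S)))
      with (v * s * (S * C' - C * S')) in Ht by ring.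
    assert (Hs : v * s * Rabs (S * C' - C * S') <= Rabs (v * s * (S * C' - C * S'))).
    { rewrite !Rabs_mult; apply Rmult_le_compat_r; [apply Rabs_pos|].
      rewrite <- Rabs_mult; apply Rle_abs. }
    pose proof (Rabs_pos S).
    assert (0 <= w * v) by (eapply Rle_trans; [apply Rabs_pos|exact E1]).
    nra.
  - apply Rabs_le_between in E1.
    assert (p * sp + m * sm <= 0) by nra.
    assert (v * (s * C') <= w * v) by nra.
    nra.
Qed.

(** * Comparison of two foldings at the base point *)

Definition base : V3 := c0 (1/4).

Definition ray (k s C S : R) : V3 :=
  vadd (vscale k (e0 (1/4))) (vscale s (vadd (vscale C (n0 (1/4))) (vscale S (b0 (1/4))))).

Definition ray_coeffs (k s : R) : Prop := Rabs k <= 1 /\ 0 < s <= 1.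

(** Describes the folding that is moved: for each [delta] it contains a short piece of a ruling on
    either side of the base point. The receiving folding is described by [fold_model]. *)
Definition fold_rays (F : R -> V3 -> Prop) (C S : R) : Prop :=
  exists kp sp km sm, ray_coeffs kp sp /\ ray_coeffs km sm /\
  vnorm (ray kp sp C S) = 1 /\ vnorm (ray km sm C (- S)) = 1 /\
  forall delta v, 0 < v < delta ->
    F delta (vadd base (vscale v (ray kp sp C S))) /\
    F delta (vadd base (vscale (- v) (ray km sm C (- S)))).

(** The choice between the two kinds of secant depends on the starting point [y] alone and is made
    before [y'] is given. The condition [eps <= rho] keeps the ruling parameters within the scale
    [rho]. *)
Definition fold_model (F : R -> V3 -> Prop) (C S : R) : Prop :=
  exists sg kp sp km sm K r, Rabs sg = 1 /\ ray_coeffs kp sp /\ ray_coeffs km sm /\ 0 <= K /\ 0 < r /\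
  forall rho eps y, rho < r -> eps <= rho -> F eps y -> vnorm (vsub y base) <= rho ->
    (forall y', F eps y' -> vnorm (vsub y' base) <= rho ->
      plus_secant y y' (vscale sg (e0 (1/4))) (ray kp sp C S) (ray km sm C (- S)) (K * rho)) \/
    (forall y', F eps y' -> vnorm (vsub y' base) <= rho ->
      minus_secant y y' (vscale sg (e0 (1/4))) (ray kp sp C S) (ray km sm C (- S)) (K * rho)).

Definition fold_crease (F : R -> V3 -> Prop) : Prop :=
  (forall delta t, 0 < delta -> I0 t -> F delta (c0 t)) /\
  (forall eps y, F eps y -> exists g, I0 g /\ vnorm (vsub y (c0 g)) <= eps).

Lemma ray_components k s C S :
  vdot (e0 (1/4)) (ray k s C S) = k /\
  vdot (n0 (1/4)) (ray k s C S) = s * C /\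
  vdot (b0 (1/4)) (ray k s C S) = s * S.
Proof.
  destruct (frame0 (1/4)) as (Hee & Hnn & Hbb & Hen & Heb & Hnb).
  unfold ray; set (e := e0 (1/4)) in *; set (n := n0 (1/4)) in *; set (b := b0 (1/4)) in *.
  repeat split.
  - replace (vdot e _) with (k * vdot e e + s * (C * vdot e n + S * vdot e b)) by v3ring.
    rewrite Hee, Hen, Heb; ring.
  - replace (vdot n _) with (k * vdot e n + s * (C * vdot n n + S * vdot n b)) by v3ring.
    rewrite Hnn, Hen, Hnb; ring.
  - replace (vdot b _) with (k * vdot e b + s * (C * vdot n b + S * vdot b b)) by v3ring.
    rewrite Hbb, Heb, Hnb; ring.
Qed.

Lemma Rabs_dot_unit_le a w h : vnorm a = 1 -> vnorm w <= h -> Rabs (vdot a w) <= h.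
Proof. intros Ha Hw; pose proof (Rabs_vdot_le a w); rewrite Ha in *; lra. Qed.

Lemma model_err_components y y' sg kp sp km sm C S d p m h :
  model_err y y' (vscale sg (e0 (1/4))) (ray kp sp C S) (ray km sm C (- S)) d p m h ->
  let w := vsub y' y in let D := Rabs d + Rabs p + Rabs m in
  Rabs (vdot (n0 (1/4)) w - (p * sp + m * sm) * C) <= h * D /\
  Rabs (vdot (b0 (1/4)) w - (p * sp - m * sm) * S) <= h * D /\
  Rabs (vdot (e0 (1/4)) w - (d * sg + p * kp + m * km)) <= h * D.
Proof.
  intros H w D; unfold model_err in H.
  destruct (frame0 (1/4)) as (Hee & Hnn & Hbb & Hen & Heb & Hnb).
  destruct (ray_components kp sp C S) as (P1 & P2 & P3).
  destruct (ray_components km sm C (- S)) as (M1 & M2 & M3).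
  fold w D in H.
  set (X := ray kp sp C S) in *; set (Y := ray km sm C (- S)) in *.
  set (err := vsub w _) in H.
  assert (Hd : forall a, vdot a err = vdot a w - (d * sg * vdot a (e0 (1/4)) + p * vdot a X + m * vdot a Y))
    by (intros a; unfold err; v3ring).
  pose proof (Rabs_dot_unit_le (e0 (1/4)) err _ (vnorm_unit _ Hee) H) as Q1.
  pose proof (Rabs_dot_unit_le (n0 (1/4)) err _ (vnorm_unit _ Hnn) H) as Q2.
  pose proof (Rabs_dot_unit_le (b0 (1/4)) err _ (vnorm_unit _ Hbb) H) as Q3.
  rewrite Hd in Q1, Q2, Q3.
  rewrite Hee, P1, M1 in Q1.
  rewrite (vdotC (n0 (1/4)) (e0 (1/4))), Hen, P2, M2 in Q2.
  rewrite (vdotC (b0 (1/4)) (e0 (1/4))), Heb, P3, M3 in Q3.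
  repeat split.
  - now replace ((p * sp + m * sm) * C) with (d * sg * 0 + p * (sp * C) + m * (sm * C)) by ring.
  - now replace ((p * sp - m * sm) * S) with (d * sg * 0 + p * (sp * S) + m * (sm * - S)) by ring.
  - now replace (d * sg + p * kp + m * km) with (d * sg * 1 + p * kp + m * km) by ring.
Qed.

Lemma exists_small_scale Q c r : 0 <= Q -> 0 < c -> 0 < r ->
  exists e, 0 < e /\ e <= r /\ forall x, 0 < x < e -> x * Q < c.
Proof.
  intros HQ Hc Hr; exists (Rmin r (c / (Q + 1))).
  assert (0 < c / (Q + 1)) by (apply Rdiv_lt_0_compat; lra).
  split; [now apply Rmin_glb_lt|split; [apply Rmin_l|]].
  intros x Hx; assert (x < c / (Q + 1)) by (pose proof (Rmin_r r (c / (Q + 1))); lra).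
  assert (x * (Q + 1) < c / (Q + 1) * (Q + 1)) by (apply Rmult_lt_compat_r; lra).
  replace (c / (Q + 1) * (Q + 1)) with c in * by (field; lra); lra.
Qed.

Lemma no_congruence F G C S C' S' :
  fold_crease F -> fold_rays F C' S' -> fold_crease G -> fold_model G C S ->
  0 < C <= 1 -> Rabs S <= 1 -> 0 < C' -> S * C' - C * S' <> 0 ->
  exists eps0, 0 < eps0 /\ forall eps delta T, 0 < eps < eps0 -> 0 < delta <= eps -> isometry3 T ->
    (forall p, F delta p -> G eps (T p)) -> False.
Proof.
  intros [Fcr _] (kp' & sp' & km' & sm' & [_ Hsp'] & [_ Hsm'] & Np & Nm & HF) [_ Gnear]
    (sg & kp & sp & km & sm & K & r & Hsg & [Hkp Hsp] & [Hkm Hsm] & HK & Hr & HG) HC HS HC' Hne.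
  destruct near_crease_near_identity as (K1 & HK1 & HL).
  set (h := Rmin sp sm * C).
  assert (Hh : 0 < h) by (apply Rmult_lt_0_compat; [apply Rmin_glb_lt|]; lra).
  set (A := Rabs (S * C' - C * S')).
  assert (HA : 0 < A) by now apply Rabs_pos_lt.
  set (s := Rmin sp' sm').
  assert (Hs : 0 < s) by (apply Rmin_glb_lt; lra).
  assert (Hs1 : s <= sp') by apply Rmin_l; assert (Hs2 : s <= sm') by apply Rmin_r.
  (* The scale [32 * eps] contains the image of the base point, at most [31 * eps] away, and that of
     a ruling piece shorter than [eps]. The bounds on [eps] put this scale below [r] and meet the
     smallness condition of [near_crease_near_identity]. *)
  destruct (exists_small_scale (6 * (K * 32)) h (Rmin (1/20000) (r / 32))) as (e1 & He1 & Hr1 & S1);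
    [lra|lra|apply Rmin_glb_lt; lra|].
  (* The product [eps * Q] is the total relative error: [K1] measures the deviation of [T] from the
     identity, the other term that of secants from their model. *)
  set (Q := K1 + 6 * (K * 32) / h).
  assert (HQ : 0 <= Q) by (unfold Q; apply Rplus_le_le_0_compat; [lra|apply Rle_mult_inv_pos; lra]).
  destruct (exists_small_scale Q (s * C') e1) as (e2 & He2 & Hr2 & S2); [lra|nra|lra|].
  destruct (exists_small_scale (2 * Q) (s * A) e2) as (e3 & He3 & Hr3 & S3); [lra|nra|lra|].
  exists e3; split; [exact He3|].
  intros eps delta T Heps Hdelta HT HFG.
  specialize (S1 eps ltac:(lra)); specialize (S2 eps ltac:(lra)); specialize (S3 eps ltac:(lra)).
  pose proof (Rmin_l (1/20000) (r / 32)); pose proof (Rmin_r (1/20000) (r / 32)).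
  assert (Hnc : near_crease T eps) by (intros t It; apply Gnear, HFG, Fcr; [lra|exact It]).
  assert (Ib : I0 (1/4)) by (unfold I0; lra).
  pose proof (near_crease_fixes_points T eps HT ltac:(lra) Hnc _ Ib) as Hb.
  fold base in Hb.
  (* Any positive length below [delta] would do: the estimates are homogeneous in [v], so no
     threshold depends on [delta]. *)
  set (v := delta / 2).
  assert (Hv : 0 < v < delta) by (unfold v; lra).
  destruct (HF delta v Hv) as (Fp & Fm).
  assert (Hray : forall c X, Rabs c = v -> vnorm X = 1 ->
    vnorm (vsub (T (vadd base (vscale c X))) (T base)) = v /\
    vnorm (vsub (T (vadd base (vscale c X))) base) <= 32 * eps /\
    vnorm (vsub (vsub (T (vadd base (vscale c X))) (T base)) (vscale c X)) <= K1 * eps * v).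
  { intros c X Hc HX.
    assert (HcX : vnorm (vscale c X) = v) by (rewrite vnorm_scale, HX, Hc; ring).
    assert (E : vnorm (vsub (T (vadd base (vscale c X))) (T base)) = v).
    { unfold isometry3, dist3 in HT; rewrite HT.
      replace (vsub (vadd base (vscale c X)) base) with (vscale c X) by v3ring; exact HcX. }
    split; [exact E|split].
    - pose proof (vnorm_sub_triangle (T (vadd base (vscale c X))) (T base) base); lra.
    - pose proof (HL T eps HT ltac:(lra) Hnc base (vscale c X)) as H1; now rewrite HcX in H1. }
  destruct (frame0 (1/4)) as (Hee & Hnn & Hbb & _).
  apply vnorm_unit in Hee; apply vnorm_unit in Hnn; apply vnorm_unit in Hbb.
  assert (Hth : 6 * (K * (32 * eps)) <= h) by lra.
  assert (Hw : K1 * eps + 6 * (K * (32 * eps)) / h = eps * Q) by (unfold Q; field; lra).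
  assert (HsC1 : s * C' <= sp' * C') by (apply Rmult_le_compat_r; lra).
  assert (HsC2 : s * C' <= sm' * C') by (apply Rmult_le_compat_r; lra).
  assert (HsA1 : s * A <= sp' * A) by (apply Rmult_le_compat_r; lra).
  assert (HsA2 : s * A <= sm' * A) by (apply Rmult_le_compat_r; lra).
  assert (0 <= K * (32 * eps)) by nra.
  assert (0 <= K1 * eps) by nra.
  (* The sheet of the receiving folding on which [T base] lies decides which of the two ruling
     pieces is tested. *)
  destruct (HG (32 * eps) eps (T base)) as [HP|HM]; try lra.
  - apply HFG, Fcr; [lra|exact Ib].
  - set (X := ray kp' sp' C' S') in *.
    destruct (Hray v X) as (V1 & V2 & V3); [apply Rabs_pos_eq; lra|exact Np|].
    destruct (HP (T (vadd base (vscale v X)))) as (d & p & m & Hpm & Herr); [now apply HFG|exact V2|].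
    apply model_err_components in Herr; destruct Herr as (EN & EB & EF).
    destruct (ray_components kp' sp' C' S') as (_ & XN & XB); fold X in XN, XB.
    set (w := vsub (T (vadd base (vscale v X))) (T base)) in *.
    assert (Hd : forall a, vdot a (vsub w (vscale v X)) = vdot a w - v * vdot a X) by (intros; v3ring).
    pose proof (Rabs_dot_unit_le _ _ _ Hnn V3) as RN; rewrite Hd, XN in RN.
    pose proof (Rabs_dot_unit_le _ _ _ Hbb V3) as RB; rewrite Hd, XB in RB.
    pose proof (Rabs_dot_unit_le _ w v Hnn ltac:(lra)).
    pose proof (Rabs_dot_unit_le _ w v Hee ltac:(lra)).
    apply (secant_angle_rigidity C S sp sm kp km sg (K * (32 * eps)) (K1 * eps) C' S' sp' v
      (vdot (n0 (1/4)) w) (vdot (b0 (1/4)) w) (vdot (e0 (1/4)) w) d p m); auto; try lra.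
    + fold h; rewrite Hw; lra.
    + fold h; rewrite Hw; fold A; lra.
  - set (X := ray km' sm' C' (- S')) in *.
    destruct (Hray (- v) X) as (V1 & V2 & V3); [rewrite Rabs_Ropp; apply Rabs_pos_eq; lra|exact Nm|].
    destruct (HM (T (vadd base (vscale (- v) X)))) as (d & p & m & Hpm & Herr); [now apply HFG|exact V2|].
    apply model_err_components in Herr; destruct Herr as (EN & EB & EF).
    destruct (ray_components km' sm' C' (- S')) as (_ & XN & XB); fold X in XN, XB.
    set (w := vsub (T (vadd base (vscale (- v) X))) (T base)) in *.
    assert (Hd : forall a, vdot a (vsub w (vscale (- v) X)) = vdot a w - - v * vdot a X) by (intros; v3ring).
    pose proof (Rabs_dot_unit_le _ _ _ Hnn V3) as RN; rewrite Hd, XN in RN.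
    pose proof (Rabs_dot_unit_le _ _ _ Hbb V3) as RB; rewrite Hd, XB in RB.
    pose proof (Rabs_dot_unit_le _ w v Hnn ltac:(lra)).
    pose proof (Rabs_dot_unit_le _ w v Hee ltac:(lra)).
    assert (HD : Rabs d + Rabs (- m) + Rabs (- p) = Rabs d + Rabs p + Rabs m)
      by (rewrite !Rabs_Ropp; ring).
    (* Reversing the normal exchanges the two sheets. *)
    apply (secant_angle_rigidity C S sm sp (- km) (- kp) sg (K * (32 * eps)) (K1 * eps) C' S' sm' v
      (- vdot (n0 (1/4)) w) (vdot (b0 (1/4)) w) (vdot (e0 (1/4)) w) d (- m) (- p));
      rewrite ?HD, ?Rabs_Ropp, ?(Rmin_comm sm sp); auto; try lra.
    + rewrite <- Rabs_Ropp.
      now replace (- (- vdot (n0 (1/4)) w - (- m * sm + - p * sp) * C))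
        with (vdot (n0 (1/4)) w - (p * sp + m * sm) * C) by ring.
    + now replace (- m * sm - - p * sp) with (p * sp - m * sm) by ring.
    + now replace (d * sg + - m * - km + - p * - kp) with (d * sg + p * kp + m * km) by ring.
    + rewrite <- Rabs_Ropp.
      now replace (- (- vdot (n0 (1/4)) w - v * (sm' * C')))
        with (vdot (n0 (1/4)) w - - v * (sm' * C')) by ring.
    + now replace (v * (sm' * S')) with (- v * (sm' * - S')) by ring.
    + fold h; rewrite Hw; lra.
    + fold h; rewrite Hw; fold A; lra.
Qed.

(** * Foldings along c0 and its reversal *)

Lemma loc_lipv_e0 x : loc_lipv e0 x.
Proof. unfold e0; repeat split; cbn [vx vy vz fst snd]; loc_lip_auto; nra. Qed.

Lemma loc_lipv_n0 x : loc_lipv n0 x.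
Proof. unfold n0; repeat split; cbn [vx vy vz fst snd]; loc_lip_auto; nra. Qed.

Lemma loc_lipv_b0 x : loc_lipv b0 x.
Proof. unfold b0; repeat split; cbn [vx vy vz fst snd]; loc_lip_auto; nra. Qed.

Lemma loc_lip_kappa0 x : loc_lip kappa0 x.
Proof. unfold kappa0; loc_lip_auto; nra. Qed.

Lemma loc_lip_reverse f x : loc_lip f (1 - x) -> loc_lip (fun t => f (1 - t)) x.
Proof. intros H; apply (loc_lip_comp f (fun t => 1 - t)); [loc_lip_auto|exact H]. Qed.

Lemma loc_lipv_reverse a X x : loc_lipv X (1 - x) -> loc_lipv (fun t => vscale a (X (1 - t))) x.
Proof.
  intros (H1 & H2 & H3); repeat split; cbn [vscale vx vy vz fst snd];
    (apply loc_lip_mult; [apply loc_lip_const|now apply (loc_lip_reverse (fun t => _ (X t)))]).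
Qed.

(** Common interface to [c0] and [c0sharp]: [phi] converts the parameter to that of [c0], [sg] is
    the relative orientation, and [t0] is the parameter of the base point. *)
Record crease_curve (s : R -> V3) (phi : R -> R) (sg t0 : R) : Prop := {
  cc_param : forall t, s t = c0 (phi t);
  cc_range : forall t, I0 t -> I0 (phi t);
  cc_invol : forall t, phi (phi t) = t;
  cc_dist : forall t, Rabs (t - t0) = Rabs (phi t - 1/4);
  cc_base : phi t0 = 1/4;
  cc_range0 : I0 t0;
  cc_sign : Rabs sg = 1;
  cc_deriv : forall t, vderiv s t (tangent s t);
  cc_ortho : forall t,
    vdot (tangent s t) (tangent s t) = 1 /\ vdot (normal s t) (normal s t) = 1 /\
    vdot (binormal s t) (binormal s t) = 1 /\ vdot (tangent s t) (normal s t) = 0 /\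
    vdot (tangent s t) (binormal s t) = 0 /\ vdot (normal s t) (binormal s t) = 0;
  cc_tangent : tangent s t0 = vscale sg (e0 (1/4));
  cc_normal : normal s t0 = n0 (1/4);
  cc_binormal : binormal s t0 = vscale sg (b0 (1/4));
  cc_lip : loc_lipv (tangent s) t0 /\ loc_lipv (normal s) t0 /\ loc_lipv (binormal s) t0 /\
    loc_lip (curvature s) t0 /\ loc_lip (torsion s) t0;
  cc_curv : curvature s t0 <> 0 }.

Lemma crease_curve_c0 : crease_curve c0 (fun t => t) 1 (1/4).
Proof.
  constructor; rewrite ?tangent_c0, ?normal_c0, ?binormal_c0, ?curvature_c0, ?torsion_c0, ?vscale_1; auto.
  - unfold I0; lra.
  - apply Rabs_R1.
  - apply c0_deriv.
  - apply frame0.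
  - auto using loc_lipv_e0, loc_lipv_n0, loc_lipv_b0, loc_lip_kappa0.
  - pose proof (kappa0_gt0 (1/4)); lra.
Qed.

Lemma crease_curve_c0sharp : crease_curve c0sharp (fun t => 1 - t) (-1) (3/4).
Proof.
  assert (E : 1 - 3/4 = 1/4) by lra.
  constructor; rewrite ?tangent_c0sharp, ?normal_c0sharp, ?binormal_c0sharp, ?curvature_c0sharp,
    ?torsion_c0sharp, ?E; auto.
  - unfold I0; intros; lra.
  - intros; ring.
  - intros t; rewrite <- Rabs_Ropp; f_equal; lra.
  - unfold I0; lra.
  - rewrite Rabs_left1; lra.
  - apply c0sharp_deriv.
  - intros t; destruct (frame0 (1 - t)) as (Hee & Hnn & Hbb & Hen & Heb & Hnb).
    set (e := e0 (1 - t)) in *; set (n := n0 (1 - t)) in *; set (b := b0 (1 - t)) in *.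
    replace (vdot (vscale (-1) e) (vscale (-1) e)) with (vdot e e) by v3ring.
    replace (vdot (vscale (-1) b) (vscale (-1) b)) with (vdot b b) by v3ring.
    replace (vdot (vscale (-1) e) n) with (- vdot e n) by v3ring.
    replace (vdot (vscale (-1) e) (vscale (-1) b)) with (vdot e b) by v3ring.
    replace (vdot n (vscale (-1) b)) with (- vdot n b) by v3ring.
    repeat split; lra.
  - split; [apply loc_lipv_reverse, loc_lipv_e0|split; [|split; [apply loc_lipv_reverse, loc_lipv_b0|]]].
    + replace (fun t => n0 (1 - t)) with (fun t => vscale 1 (n0 (1 - t)))
        by (extensionality u; apply vscale_1).
      apply loc_lipv_reverse, loc_lipv_n0.
    + split; apply loc_lip_reverse, loc_lip_kappa0.
  - pose proof (kappa0_gt0 (1/4)); lra.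
Qed.

Lemma sin_dev_beta_gt0 s a t : 0 < sin (dev_beta s a t) <= 1.
Proof.
  split; [|apply SIN_bound].
  pose proof (atan_bound ((Dr a t + torsion s t) / (curvature s t * sin (a t)))).
  pose proof PI_RGT_0; apply sin_gt_0; unfold dev_beta; lra.
Qed.

Lemma ruling_unit s phi sg t0 a t (Hs : crease_curve s phi sg t0) : vnorm (ruling s a t) = 1.
Proof.
  apply vnorm_unit; destruct (cc_ortho _ _ _ _ Hs t) as (Hee & Hnn & Hbb & Hen & Heb & Hnb).
  unfold ruling; cbn zeta; set (be := dev_beta s a t).
  set (e := tangent s t) in *; set (n := normal s t) in *; set (b := binormal s t) in *.
  pose proof (sin2_cos2 be) as E1; pose proof (sin2_cos2 (a t)) as E2; unfold Rsqr in E1, E2.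
  replace (vdot _ _) with
    (cos be * cos be * vdot e e + sin be * sin be * (cos (a t) * cos (a t) * vdot n n
      + sin (a t) * sin (a t) * vdot b b + 2 * (cos (a t) * sin (a t)) * vdot n b)
      + 2 * (cos be * sin be) * (cos (a t) * vdot e n + sin (a t) * vdot e b)) by v3ring.
  rewrite Hee, Hnn, Hbb, Hen, Heb, Hnb; nra.
Qed.

Lemma ruling_ray s phi sg t0 a (Hs : crease_curve s phi sg t0) : ruling s a t0 =
  ray (sg * cos (dev_beta s a t0)) (sin (dev_beta s a t0)) (cos (a t0)) (sg * sin (a t0)).
Proof.
  unfold ruling, ray; cbn zeta.
  rewrite (cc_tangent _ _ _ _ Hs), (cc_normal _ _ _ _ Hs), (cc_binormal _ _ _ _ Hs); v3ring.
Qed.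

Lemma ruling_coeffs s phi sg t0 a (Hs : crease_curve s phi sg t0) : ray_coeffs (sg * cos (dev_beta s a t0)) (sin (dev_beta s a t0)).
Proof.
  split; [|apply sin_dev_beta_gt0].
  rewrite Rabs_mult, (cc_sign _ _ _ _ Hs), Rmult_1_l; apply Rabs_le, COS_bound.
Qed.

Lemma dual_ruling_ray s phi sg t0 a (Hs : crease_curve s phi sg t0) : ruling s (fun u => - a u) t0 =
  ray (sg * cos (dev_beta s (fun u => - a u) t0)) (sin (dev_beta s (fun u => - a u) t0))
    (cos (a t0)) (- (sg * sin (a t0))).
Proof. rewrite (ruling_ray _ _ _ _ _ Hs), cos_neg, sin_neg; f_equal; ring. Qed.

Lemma phi_map_dist s phi sg t0 a t v (Hs : crease_curve s phi sg t0) : vnorm (vsub (phi_map s a t v) (s t)) = Rabs v.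
Proof.
  unfold phi_map, dev_strip; destruct (Rle_dec 0 v);
  match goal with |- vnorm (vsub (vadd ?p (vscale ?c ?X)) ?p) = _ =>
    replace (vsub (vadd p (vscale c X)) p) with (vscale c X) by v3ring end;
  now rewrite vnorm_scale, (ruling_unit _ _ _ _ _ _ Hs), Rmult_1_r.
Qed.

Lemma folding_crease s phi sg t0 a (Hs : crease_curve s phi sg t0) : fold_crease (folding s a).
Proof.
  split.
  - intros delta t Hd It; exists (phi t), 0.
    split; [apply (cc_range _ _ _ _ Hs), It|split; [lra|]].
    unfold phi_map, dev_strip; destruct (Rle_dec 0 0) as [_|]; [|lra].
    rewrite (cc_param _ _ _ _ Hs), (cc_invol _ _ _ _ Hs).
    destruct (c0 t) as [[? ?] ?]; v3ring.
  - intros eps y (t & v & It & Hv & ->).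
    exists (phi t); split; [apply (cc_range _ _ _ _ Hs), It|].
    rewrite <- (cc_param _ _ _ _ Hs), (phi_map_dist _ _ _ _ _ _ _ Hs); apply Rabs_le; lra.
Qed.

Lemma folding_rays s phi sg t0 a (Hs : crease_curve s phi sg t0) : fold_rays (folding s a) (cos (a t0)) (sg * sin (a t0)).
Proof.
  exists (sg * cos (dev_beta s a t0)), (sin (dev_beta s a t0)),
    (sg * cos (dev_beta s (fun u => - a u) t0)), (sin (dev_beta s (fun u => - a u) t0)).
  split; [eapply ruling_coeffs, Hs|split; [eapply ruling_coeffs, Hs|]].
  rewrite <- (dual_ruling_ray _ _ _ _ _ Hs), <- (ruling_ray _ _ _ _ _ Hs).
  split; [eapply ruling_unit, Hs|split; [eapply ruling_unit, Hs|]].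
  intros delta v Hv; unfold base; rewrite <- (cc_base _ _ _ _ Hs), <- (cc_param _ _ _ _ Hs).
  split.
  - exists t0, v; split; [apply (cc_range0 _ _ _ _ Hs)|split; [lra|]].
    unfold phi_map; destruct (Rle_dec 0 v); [reflexivity|lra].
  - exists t0, (- v); split; [apply (cc_range0 _ _ _ _ Hs)|split; [lra|]].
    unfold phi_map; destruct (Rle_dec 0 (- v)); [lra|reflexivity].
Qed.

Lemma loc_lipv_ruling s phi sg t0 a (Hs : crease_curve s phi sg t0) : loc_lip a t0 -> loc_lip (Dr a) t0 -> sin (a t0) <> 0 ->
  loc_lipv (ruling s a) t0.
Proof.
  intros Ha HDa Hsin.
  destruct (cc_lip _ _ _ _ Hs) as ((T1 & T2 & T3) & (N1 & N2 & N3) & (B1 & B2 & B3) & Hk & Htau).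
  pose proof (cc_curv _ _ _ _ Hs) as Hk0.
  assert (Hbe : loc_lip (dev_beta s a) t0).
  { unfold dev_beta; loc_lip_auto; now apply Rmult_integral_contrapositive_currified. }
  unfold ruling; repeat split; cbn [vadd vscale vx vy vz fst snd]; loc_lip_auto.
Qed.

Lemma folding_model s phi sg t0 a (Hs : crease_curve s phi sg t0) : loc_lip a t0 -> loc_lip (Dr a) t0 -> loc_lip (Dr (fun u => - a u)) t0 ->
  sin (a t0) <> 0 -> fold_model (folding s a) (cos (a t0)) (sg * sin (a t0)).
Proof.
  intros Ha HDa HDna Hsin.
  destruct (secant_model s a (tangent s) t0) as (K & r & HK & Hr & H).
  - apply (cc_deriv _ _ _ _ Hs).
  - apply (cc_lip _ _ _ _ Hs).
  - now apply (loc_lipv_ruling _ _ _ _ _ Hs).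
  - apply (loc_lipv_ruling _ _ _ _ _ Hs); auto; [now apply loc_lip_opp|rewrite sin_neg; lra].
  - exists sg, (sg * cos (dev_beta s a t0)), (sin (dev_beta s a t0)),
      (sg * cos (dev_beta s (fun u => - a u) t0)), (sin (dev_beta s (fun u => - a u) t0)), (3 * K), (r / 3).
    split; [apply (cc_sign _ _ _ _ Hs)|split; [eapply ruling_coeffs, Hs|split; [eapply ruling_coeffs, Hs|]]].
    split; [lra|split; [lra|]].
    rewrite <- (dual_ruling_ray _ _ _ _ _ Hs), <- (ruling_ray _ _ _ _ _ Hs), <- (cc_tangent _ _ _ _ Hs).
    (* A point of the folding within [rho] of the base point has its foot on the crease within
       [2 * rho], so by [chord_ge] its parameter is within [8/3 * rho] of [t0]. *)
    assert (Hloc : forall rho eps t v, eps <= rho -> I0 t -> - eps < v < eps ->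
      vnorm (vsub (phi_map s a t v) base) <= rho -> Rabs (t - t0) <= 3 * rho /\ Rabs v <= 3 * rho).
    { intros rho eps t v He It Hv Hy.
      assert (Hv' : Rabs v <= rho) by (apply Rabs_le; lra).
      pose proof (Rabs_pos v); split; [|lra].
      rewrite (cc_dist _ _ _ _ Hs).
      pose proof (chord_ge (1/4) (phi t) ltac:(unfold I0; lra) (cc_range _ _ _ _ Hs _ It)) as Hc.
      unfold chord in Hc; rewrite <- (cc_param _ _ _ _ Hs) in Hc; fold base in Hc.
      pose proof (vnorm_sub_triangle (s t) (phi_map s a t v) base) as Ht.
      rewrite (vnorm_subC (s t) (phi_map s a t v)), (phi_map_dist _ _ _ _ _ _ _ Hs) in Ht; lra. }
    intros rho eps y Hrho He (t & v & It & Hv & ->) Hy.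
    destruct (Hloc rho eps t v He It Hv Hy) as (Ht & Hv').
    replace (3 * K * rho) with (K * (3 * rho)) by ring.
    destruct (H (3 * rho) t v ltac:(lra) Ht Hv') as [HP|HM]; [left|right];
      intros y' (t' & v' & It' & Hv1 & ->) Hy';
      destruct (Hloc rho eps t' v' He It' Hv1 Hy'); auto.
Qed.

(** * The angular functions *)

(** An explicit derivative near [t0] is enough, since the model is local; for [alpha_star] a formula
    is established on the interval from 1/2 to 1 around 3/4. *)
Lemma folding_model_of_deriv s phi sg t0 a a' r (Hs : crease_curve s phi sg t0) :
  0 < r -> (forall t, Rabs (t - t0) < r -> derivable_pt_lim a t (a' t)) -> loc_lip a' t0 ->
  sin (a t0) <> 0 -> fold_model (folding s a) (cos (a t0)) (sg * sin (a t0)).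
Proof.
  intros Hr Hd Ha' Hsin; eapply folding_model; eauto.
  - now apply (loc_lip_of_deriv a a' t0 r).
  - apply (loc_lip_ext_near _ a' t0 r); auto; intros t Ht; apply Dr_eq; auto.
  - apply (loc_lip_ext_near _ (fun t => - a' t) t0 r); [auto| |now apply loc_lip_opp].
    intros t Ht; apply Dr_eq, (derivable_pt_lim_opp a); auto.
Qed.

Lemma folding_model_dual s phi sg t0 a a' r (Hs : crease_curve s phi sg t0) :
  0 < r -> (forall t, Rabs (t - t0) < r -> derivable_pt_lim a t (a' t)) -> loc_lip a' t0 ->
  sin (a t0) <> 0 -> fold_model (folding s (fun u => - a u)) (cos (a t0)) (- (sg * sin (a t0))).
Proof.
  intros Hr Hd Ha' Hsin.
  rewrite <- cos_neg; replace (- (sg * sin (a t0))) with (sg * sin (- a t0)) by (rewrite sin_neg; ring).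
  apply (folding_model_of_deriv s phi sg t0 (fun u => - a u) (fun t => - a' t) r Hs); auto.
  - intros t Ht; now apply (derivable_pt_lim_opp a), Hd.
  - now apply loc_lip_opp.
  - rewrite sin_neg; lra.
Qed.

Lemma folding_rays_dual s phi sg t0 a (Hs : crease_curve s phi sg t0) :
  fold_rays (folding s (fun u => - a u)) (cos (a t0)) (- (sg * sin (a t0))).
Proof.
  rewrite <- cos_neg; replace (- (sg * sin (a t0))) with (sg * sin (- a t0)) by (rewrite sin_neg; ring).
  apply (folding_rays s phi sg t0 (fun u => - a u) Hs).
Qed.

Lemma alpha0_deriv t : derivable_pt_lim alpha0 t (PI / 24).
Proof. unfold alpha0; apply is_derive_Reals; auto_derive; auto; field. Qed.

Lemma alpha0_bounds t : -10 < t < 2 -> 0 < alpha0 t < PI / 2.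
Proof. unfold alpha0; pose proof PI_RGT_0; intros; split; nra. Qed.

Definition cos_star (t : R) : R := (1 + (1 - t) ^ 2) / (1 + t ^ 2) * cos (alpha0 t).
Definition cos_star' (t : R) : R :=
  ((- (2 * (1 - t))) * (1 + t ^ 2) - (1 + (1 - t) ^ 2) * (2 * t)) / (1 + t ^ 2) ^ 2 * cos (alpha0 t)
  - (1 + (1 - t) ^ 2) / (1 + t ^ 2) * (sin (alpha0 t) * (PI / 24)).

Lemma alpha_star_eq t : alpha_star t = acos (cos_star t).
Proof.
  unfold alpha_star, mu0, cos_star; rewrite curvature_c0, curvature_c0sharp.
  unfold kappa0; f_equal; pose proof sqrt2_gt0; field; repeat split; nra.
Qed.

Lemma cos_star_deriv t : derivable_pt_lim cos_star t (cos_star' t).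
Proof.
  unfold cos_star, cos_star', alpha0; apply is_derive_Reals; auto_derive; [nra|]; unfold Rdiv in *; field; nra.
Qed.

(** Beyond 1/2 the curvature ratio is less than 1, which keeps the argument of [acos] inside the
    interval where it is differentiable. *)
Lemma cos_star_bounds t : 1/2 < t < 1 -> 0 < cos_star t < 1.
Proof.
  intros Ht; destruct (alpha0_bounds t) as [Ha Ha']; [lra|].
  assert (Hc : 0 < cos (alpha0 t) < 1).
  { split; [apply cos_gt_0; lra|].
    rewrite <- cos_0; apply cos_decreasing_1; lra. }
  assert (Hq : 0 < (1 + (1 - t) ^ 2) / (1 + t ^ 2)) by (apply Rdiv_lt_0_compat; nra).
  assert ((1 + (1 - t) ^ 2) / (1 + t ^ 2) < 1)
    by (apply (Rlt_div_l _ _ _ (one_plus_sqr_gt0 t)); nra).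
  unfold cos_star; split; nra.
Qed.

Lemma alpha_star_deriv t : 1/2 < t < 1 ->
  derivable_pt_lim alpha_star t (- 1 / sqrt (1 - (cos_star t)²) * cos_star' t).
Proof.
  intros Ht; replace alpha_star with (fun u => acos (cos_star u))
    by (extensionality u; symmetry; apply alpha_star_eq).
  apply (derivable_pt_lim_comp cos_star acos); [apply cos_star_deriv|].
  assert (Hb : -1 < cos_star t < 1) by (pose proof (cos_star_bounds t Ht); lra).
  exact (derive_pt_eq_1 _ _ _ _ (derive_pt_acos _ Hb)).
Qed.

Lemma loc_lip_alpha_star_deriv :
  loc_lip (fun t => - 1 / sqrt (1 - (cos_star t)²) * cos_star' t) (3/4).
Proof.
  pose proof (cos_star_bounds (3/4) ltac:(lra)) as Hb.
  assert (Hc : loc_lip alpha0 (3/4)) by (unfold alpha0; loc_lip_auto; lra).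
  assert (H1 : loc_lip cos_star (3/4)) by (unfold cos_star; loc_lip_auto; lra).
  assert (H2 : loc_lip cos_star' (3/4)) by (unfold cos_star'; loc_lip_auto; nra).
  assert (Hp : 0 < 1 - (cos_star (3/4))²) by (unfold Rsqr; nra).
  apply loc_lip_mult; [apply loc_lip_div; [apply Rgt_not_eq, sqrt_lt_R0, Hp|apply loc_lip_const|]|exact H2].
  apply loc_lip_sqrt; [exact Hp|]; unfold Rsqr; loc_lip_auto.
Qed.

(** Both curves pass through the base point, [c0sharp] at 3/4, with the same curvature there. The
    angles differ because curvature and cosine of [alpha0] are both smaller at 3/4 than at 1/4. *)
Lemma alpha_star_angle : 0 < cos (alpha_star (3/4)) < cos (alpha0 (1/4)) /\
  0 < sin (alpha0 (1/4)) < sin (alpha_star (3/4)).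
Proof.
  pose proof (cos_star_bounds (3/4) ltac:(lra)) as Hb.
  destruct (alpha0_bounds (1/4)) as [A1 A2]; [lra|].
  destruct (alpha0_bounds (3/4)) as [B1 B2]; [lra|].
  assert (HC : cos (alpha_star (3/4)) = cos_star (3/4)) by (rewrite alpha_star_eq; apply cos_acos; lra).
  assert (HC0 : 0 < cos (alpha0 (3/4)) < cos (alpha0 (1/4))).
  { split; [apply cos_gt_0; lra|].
    apply cos_decreasing_1; try lra; unfold alpha0; pose proof PI_RGT_0; nra. }
  assert (HS0 : 0 < sin (alpha0 (1/4))) by (apply sin_gt_0; lra).
  assert (HS : 0 <= sin (alpha_star (3/4)))
    by (pose proof (acos_bound (cos_star (3/4))); rewrite alpha_star_eq; apply sin_ge_0; lra).
  assert (Hlt : cos_star (3/4) < cos (alpha0 (1/4))) by (unfold cos_star; lra).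
  rewrite HC; split; [lra|split; [lra|]].
  pose proof (sin2_cos2 (alpha_star (3/4))) as E1; pose proof (sin2_cos2 (alpha0 (1/4))) as E2.
  rewrite HC in E1; unfold Rsqr in *; nra.
Qed.

(** * The four foldings and the conclusion *)

Definition fold_cos (i : nat) : R :=
  match i with 1%nat | 2%nat => cos (alpha0 (1/4)) | _ => cos (alpha_star (3/4)) end.
(* Reversing the crease reverses the binormal, hence the opposite signs for i = 3, 4. *)
Definition fold_sin (i : nat) : R :=
  match i with
  | 1%nat => sin (alpha0 (1/4)) | 2%nat => - sin (alpha0 (1/4))
  | 3%nat => - sin (alpha_star (3/4)) | _ => sin (alpha_star (3/4))
  end.

Lemma Pfold_data i : (1 <= i <= 4)%nat ->
  fold_crease (Pfold i) /\ fold_rays (Pfold i) (fold_cos i) (fold_sin i) /\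
  fold_model (Pfold i) (fold_cos i) (fold_sin i).
Proof.
  intros Hi.
  pose proof crease_curve_c0 as H0; pose proof crease_curve_c0sharp as H1.
  destruct alpha_star_angle as [HC HS].
  assert (D0 : forall t, Rabs (t - 1/4) < 1 -> derivable_pt_lim alpha0 t ((fun _ => PI / 24) t))
    by (intros; apply alpha0_deriv).
  assert (L0 : loc_lip (fun _ => PI / 24) (1/4)) by apply loc_lip_const.
  assert (D1 : forall t, Rabs (t - 3/4) < 1/4 ->
    derivable_pt_lim alpha_star t ((fun t => - 1 / sqrt (1 - (cos_star t)²) * cos_star' t) t))
    by (intros t Ht; apply Rabs_def2 in Ht; apply alpha_star_deriv; lra).
  pose proof loc_lip_alpha_star_deriv as L1.
  assert (Hi' : i = 1%nat \/ i = 2%nat \/ i = 3%nat \/ i = 4%nat) by lia.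
  destruct Hi' as [->|[->|[->| ->]]]; cbn [Pfold fold_cos fold_sin].
  - rewrite <- (Rmult_1_l (sin _)).
    split; [eapply folding_crease, H0|split; [eapply folding_rays, H0|]].
    eapply folding_model_of_deriv; eauto; lra.
  - rewrite <- (Rmult_1_l (sin _)).
    split; [eapply folding_crease, H0|split; [eapply folding_rays_dual, H0|]].
    eapply folding_model_dual; eauto; lra.
  - replace (- sin (alpha_star (3/4))) with (-1 * sin (alpha_star (3/4))) by ring.
    split; [eapply folding_crease, H1|split; [eapply folding_rays, H1|]].
    eapply folding_model_of_deriv with (r := 1/4); eauto; lra.
  - replace (sin (alpha_star (3/4))) with (- (-1 * sin (alpha_star (3/4)))) by ring.
    split; [eapply folding_crease, H1|split; [eapply folding_rays_dual, H1|]].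
    eapply folding_model_dual with (r := 1/4); eauto; lra.
Qed.

(** The expression is the sine of the difference of two signed angles. All four lie strictly between
    [- PI / 2] and [PI / 2], and they are distinct by [alpha_star_angle] and their signs. *)
Lemma fold_angles_distinct i j : (1 <= i <= 4)%nat -> (1 <= j <= 4)%nat -> i <> j ->
  fold_sin j * fold_cos i - fold_cos j * fold_sin i <> 0.
Proof.
  intros Hi Hj Hij; destruct alpha_star_angle as [HC HS].
  assert (Hi' : i = 1%nat \/ i = 2%nat \/ i = 3%nat \/ i = 4%nat) by lia.
  assert (Hj' : j = 1%nat \/ j = 2%nat \/ j = 3%nat \/ j = 4%nat) by lia.
  destruct Hi' as [->|[->|[->| ->]]], Hj' as [->|[->|[->| ->]]]; try lia;
    cbn [fold_cos fold_sin]; nra.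
Qed.

(** Turns a threshold for each pair of foldings into a single one; the theorem applies it first over
    the target and then over the source. *)
Lemma uniform_threshold (P : nat -> R -> Prop) n :
  (forall i, (1 <= i <= n)%nat -> exists e, 0 < e /\ forall x, 0 < x < e -> P i x) ->
  exists e, 0 < e /\ forall x, 0 < x < e -> forall i, (1 <= i <= n)%nat -> P i x.
Proof.
  induction n as [|n IH]; intros H.
  - exists 1; split; [lra|intros; lia].
  - destruct IH as (e & He & IH); [intros i Hi; apply H; lia|].
    destruct (H (S n)) as (e' & He' & H'); [lia|].
    exists (Rmin e e'); split; [now apply Rmin_glb_lt|].
    intros x Hx i Hi; pose proof (Rmin_l e e'); pose proof (Rmin_r e e').
    destruct (Nat.eq_dec i (S n)) as [->|]; [apply H'; lra|apply IH; [lra|lia]].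
Qed.

Theorem theoremB :
  exists eps0 : R, 0 < eps0 /\
  forall eps : R, 0 < eps < eps0 ->
  forall delta : R, 0 < delta <= eps ->
  forall i j : nat, (1 <= i <= 4)%nat -> (1 <= j <= 4)%nat ->
  forall T : V3 -> V3, isometry3 T ->
  (forall p, Pfold i delta p -> Pfold j eps (T p)) ->
  i = j.
Proof.
  destruct (uniform_threshold (fun i eps => forall j, (1 <= j <= 4)%nat -> forall delta, 0 < delta <= eps ->
    forall T, isometry3 T -> (forall p, Pfold i delta p -> Pfold j eps (T p)) -> i = j) 4) as (e & He & H).
  - intros i Hi; destruct (uniform_threshold (fun j eps => forall delta, 0 < delta <= eps ->
      forall T, isometry3 T -> (forall p, Pfold i delta p -> Pfold j eps (T p)) -> i = j) 4) as (e & He & H).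
    + intros j Hj; destruct (Nat.eq_dec i j) as [Hij|Hij]; [exists 1; split; [lra|auto]|].
      destruct (Pfold_data i Hi) as (Ci & Ri & _), (Pfold_data j Hj) as (Cj & _ & Mj).
      destruct (no_congruence (Pfold i) (Pfold j) (fold_cos j) (fold_sin j) (fold_cos i) (fold_sin i))
        as (e & He & H); auto using fold_angles_distinct.
      * destruct alpha_star_angle; pose proof (COS_bound (alpha0 (1/4))).
        destruct j as [|[|[|j]]]; cbn [fold_cos]; lra.
      * destruct j as [|[|[|[|j]]]]; cbn [fold_sin]; rewrite ?Rabs_Ropp; apply Rabs_le, SIN_bound.
      * destruct alpha_star_angle; destruct i as [|[|[|i]]]; cbn [fold_cos]; lra.
      * exists e; split; [exact He|].
        intros x Hx delta Hd T HT HP; exfalso; eapply (H x delta T); eauto.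
    + exists e; split; [exact He|]; intros x Hx j Hj; now apply H.
  - exists e; split; [exact He|].
    intros eps Heps delta Hdelta i j Hi Hj T HT HP; eapply H; eauto.
Qed.
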